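(* Let $a>0$, $y\in\mathbb{C}$, and let $\lambda,\mu,v\in\mathbb{C}$ satisfy $\Re(v)>-1$ and $0<\Re(\mu)<\Re(\lambda)$. Then $$\int_{0}^{\infty }x^{\mu -1}\left( x+a+\sqrt{x^{2}+2ax}\right)^{-\lambda } J_{v}\left( \frac{xy}{x+a+\sqrt{x^{2}+2ax}}\right) dx = 2^{1-\mu}a^{\mu-\lambda}\,\Gamma(\lambda-\mu)\; {}_{2}\Psi_{3}\left[ \begin{array}{c} (\lambda +1,1),\ (2\mu,2); \\ (v+1,1),\ (1+\lambda+\mu ,2),\ (\lambda ,1); \end{array} -\frac{y}{2}\right].$$
   Context: Here $J_v$ denotes the Bessel-Maitland function $J_{v}^{\delta}(z)=\sum_{n=0}^{\infty}\frac{(-z)^n}{n!\,\Gamma(\delta n+v+1)}$ with $\delta=1$, i.e. $J_v(z)=\sum_{n=0}^{\infty}\frac{(-z)^n}{n!\,\Gamma(n+v+1)}$ (this is not the classical normalization of the Bessel function of the first kind). The generalized Wright hypergeometric function is the series ${}_{p}\Psi_{r}\left[\begin{array}{c}(a_1,\alpha_1),\dots,(a_p,\alpha_p);\\ (b_1,\beta_1),\dots,(b_r,\beta_r);\end{array} z\right]=\sum_{k=0}^{\infty}\frac{\prod_{i=1}^{p}\Gamma(a_i+\alpha_i k)}{\prod_{j=1}^{r}\Gamma(b_j+\beta_j k)}\frac{z^k}{k!}$. Here $1/\Gamma$ is the entire reciprocal Gamma function, and powers of positive reals with complex exponents are the principal ones. *)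

(* Defs.v *)
From Stdlib Require Import Reals Factorial List.
From Coquelicot Require Import Coquelicot.
Import ListNotations.

Open Scope R_scope.

Definition Cexp (z : C) : C :=
  (exp (Re z) * cos (Im z), exp (Re z) * sin (Im z)).

(* Principal power [x ^ s] of a positive real [x]; only meaningful for [0 < x]. *)
Definition Rcpow (x : R) (s : C) : C := Cexp (s * RtoC (ln x))%C.

(* Coquelicot's [Series] is real-valued; as in its [RInt_gen], the value is
   unspecified when the series diverges. *)
Definition CSeries (a : nat -> C) : C :=
  iota (T := C_R_CompleteNormedModule) (is_series (V := C_R_NormedModule) a).

(* Euler's integral, convergent for [0 < Re z]. *)
Definition Euler_Gamma (z : C) : C :=
  RInt_gen (V := C_R_CompleteNormedModule)
    (fun t : R => (Rcpow t (z - 1) * RtoC (exp (- t)))%C)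
    (at_right 0) (Rbar_locally p_infty).

Fixpoint rising (z : C) (n : nat) : C :=
  match n with
  | O => 1%C
  | S m => (rising z m * (z + RtoC (INR m)))%C
  end.

(* A natural number with [0 < Re z + Gamma_shift z]; it is 0 when [0 < Re z]. *)
Definition Gamma_shift (z : C) : nat := Z.to_nat (up (- Re z)).

(* The Gamma function, continued to the left half-plane by
   [Gamma (z + n) = z (z + 1) ... (z + n - 1) Gamma z]; at the poles
   0, -1, -2, ... the total inverse gives the junk value 0. *)
Definition Gamma (z : C) : C :=
  let n := Gamma_shift z in
  (Euler_Gamma (z + RtoC (INR n)) / rising z n)%C.

(* The entire reciprocal Gamma function: it vanishes at 0, -1, -2, ... through
   the factor [rising], not through the convention for the inverse of 0. *)
Definition rGamma (z : C) : C :=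
  let n := Gamma_shift z in
  (rising z n / Euler_Gamma (z + RtoC (INR n)))%C.

Definition Bessel_Maitland_term (delta : R) (v z : C) (n : nat) : C :=
  ((- z) ^ n / RtoC (INR (fact n))
   * rGamma (RtoC (delta * INR n) + v + 1))%C.

Definition Bessel_Maitland (delta : R) (v z : C) : C :=
  CSeries (Bessel_Maitland_term delta v z).

Definition BesselJ (v z : C) : C := Bessel_Maitland 1 v z.

Definition Cprod (l : list C) : C := fold_right Cmult 1%C l.

(* The upper and lower parameters of the Wright function are the lists of pairs
   (a_i, alpha_i) and (b_j, beta_j). *)
Definition Wright_term (upper lower : list (C * R)) (z : C) (k : nat) : C :=
  (Cprod (map (fun p => Gamma (fst p + RtoC (snd p * INR k))) upper)
   * Cprod (map (fun q => rGamma (fst q + RtoC (snd q * INR k))) lower)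
   * (z ^ k / RtoC (INR (fact k))))%C.

Definition Wright_Psi (upper lower : list (C * R)) (z : C) : C :=
  CSeries (Wright_term upper lower z).

(* Main.v *)
Require Import Defs.
From Stdlib Require Import Reals Factorial List Lra Lia.
From Coquelicot Require Import Coquelicot.
Import ListNotations.
Open Scope R_scope.

(** The substitution x = a (cosh t - 1) makes w = x + a + sqrt (x^2 + 2 a x) equal to a exp t
    and x / w equal to (1 - exp (-t))^2 / 2, so that the integral becomes, up to the constant
    2^(-mu) a^(mu - lambda),
      int_0^oo exp (- (lambda - mu) t) (1 - exp (-t))^(2 mu - 1) (1 + exp (-t))
               J_v (y (1 - exp (-t))^2 / 2) dt
    ([integrand_subst]).  The argument of J_v stays bounded, so its series can be integrated
    term by term ([is_int_series]).  Each term is a sum B(p, q) + B(p + 1, q) of two Beta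
    integrals, with p = lambda - mu and q = 2 mu + 2 n, and equals
    (2 p + q) Gamma(p) Gamma(q) / Gamma(p + q + 1) ([beta_sum_value]).  Since
    2 p + q = 2 (lambda + n) and lambda + n = Gamma(lambda + n + 1) / Gamma(lambda + n),
    these are the terms of the Wright series.  This last step divides by Gamma(lambda + n),
    and therefore rests on the absence of zeros of Gamma in the right half-plane.

    All integrals are kept on the half-line t > 0, the Beta integral being written
      B(p, q) = int_0^oo exp (-p t) (1 - exp (-t))^(q - 1) dt,
    and all are dominated by K t^(al - 1) exp (-be t); [is_int_power_exp_bound] gives at once
    convergence and a bound that decays like be^(-al) for large be.

    The relation of B to Gamma uses no double integral.  For large N the kernel of
    B(p + N, q) is close to that of the rescaled Gamma integral N^(-q) Gamma(q), so
    N^q B(p + N, q) = Gamma(q) + O(1/N) ([beta_scaled_close]).  Integration by parts gives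
    p B(p, q) = (p + q) B(p + 1, q), hence q (q+1) ... (q+m) B(m + 1, q) = m! ([beta_int_nat]).
    - If Gamma(q) were 0, then |B(N, q)| would be O(N^(-Re q - 1)), and the last identity would force
      the product q (q+1) ... (q+m) to be larger than it is ([Euler_Gamma_neq_0]).
    - Eliminating the products q (q+1) ... between these relations gives
      B(p, q) N^(p+q) B(N, p + q) = N^p B(N, p) N^q B(p + N, q),
      whose limit is B(p, q) Gamma(p + q) = Gamma(p) Gamma(q) ([beta_int_Gamma]). *)

(** * Improper integrals over the positive half-line *)

Notation is_int f I :=
  (is_RInt_gen (V := C_R_NormedModule) f (at_right 0) (Rbar_locally p_infty) I).

Lemma eventually_ends_pos :
  filter_prod (at_right 0) (Rbar_locally p_infty)
    (fun ab : R * R => 0 < fst ab <= snd ab).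
Proof.
  apply Filter_prod with (Q := fun x => 0 < x < 1) (R := fun x => 1 < x).
  - exists (mkposreal 1 Rlt_0_1); simpl; intros y Hy H.
    unfold ball in Hy; simpl in Hy; unfold AbsRing_ball, abs, minus, plus, opp in Hy.
    simpl in Hy. apply Rabs_def2 in Hy. lra.
  - exists 1. auto.
  - simpl; intros; lra.
Qed.

(** The fundamental theorem of calculus for improper integrals; [F] is only controlled
    through its limits at the two ends. *)
Lemma is_RInt_gen_of_primitive {V : CompleteNormedModule R_AbsRing}
    (F f : R -> V) (l0 l1 : V) :
  (forall x, 0 < x -> is_derive F x (f x)) ->
  (forall x, 0 < x -> continuous f x) ->
  filterlim F (at_right 0) (locally l0) ->
  filterlim F (Rbar_locally p_infty) (locally l1) ->
  is_RInt_gen f (at_right 0) (Rbar_locally p_infty) (minus l1 l0).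
Proof.
  intros dF cf F0 F1.
  apply (filterlimi_lim_ext_loc (fun ab => minus (F (snd ab)) (F (fst ab)))).
  - generalize eventually_ends_pos; apply filter_imp; intros [a b] Hab; simpl in *.
    apply is_RInt_derive; intros x Hx; rewrite Rmin_left in Hx by lra;
      [apply dF | apply cf]; lra.
  - apply (filterlim_comp_2 (G := locally l1) (H := locally (opp l0))
      (fun ab => F (snd ab)) (fun ab => opp (F (fst ab))) plus);
      [ | | apply (filterlim_plus l1 (opp l0))].
    + eapply filterlim_comp; [apply filterlim_snd | exact F1].
    + eapply filterlim_comp; [eapply filterlim_comp; [apply filterlim_fst | exact F0] |].
      apply (filterlim_opp l0).
Qed.

(** Bounding by the increments of one fixed primitive [H], rather than by an integral of a
    norm, makes these estimates additive in the endpoints. *)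
Lemma is_RInt_dominated (f : R -> C) (H h : R -> R) :
  (forall x, 0 < x -> continuous (T := R_UniformSpace) (U := C_R_NormedModule) f x) ->
  (forall x, 0 < x -> is_derive H x (h x)) ->
  (forall x, 0 < x -> continuous h x) ->
  (forall x, 0 < x -> Cmod (f x) <= h x) ->
  forall a b, 0 < a -> 0 < b ->
  exists J, is_RInt (V := C_R_NormedModule) f a b J /\ Cmod J <= Rabs (H b - H a).
Proof.
  intros cf dH ch fh.
  assert (K : forall a b, 0 < a -> a <= b ->
     exists J, is_RInt (V := C_R_NormedModule) f a b J /\ Cmod J <= H b - H a).
  { intros a b ha hab.
    destruct (ex_RInt_continuous (V := C_R_CompleteNormedModule) f a b) as [J HJ].
    { intros z Hz; rewrite Rmin_left in Hz by lra; apply cf; lra. }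
    exists J; split; [exact HJ|].
    rewrite Cmod_norm.
    apply (norm_RInt_le (V := C_R_NormedModule) f h a b J (H b - H a)); auto.
    - intros x Hx; rewrite <- Cmod_norm; apply fh; lra.
    - apply (is_RInt_derive H h); intros x Hx; rewrite Rmin_left in Hx by lra;
      [apply dH | apply ch]; lra. }
  intros a b ha hb.
  destruct (Rle_dec a b) as [hab|hab].
  - destruct (K a b ha hab) as [J [HJ1 HJ2]]. exists J; split; auto.
    eapply Rle_trans; [exact HJ2|apply Rle_abs].
  - destruct (K b a hb) as [J [HJ1 HJ2]]; [lra|].
    exists (opp J : C_R_NormedModule); split.
    + apply is_RInt_swap. exact HJ1.
    + replace (opp J : C_R_NormedModule) with (- J)%C by reflexivity.
      rewrite Cmod_opp, Rabs_minus_sym.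
      eapply Rle_trans; [exact HJ2|apply Rle_abs].
Qed.

(** Comparison test: by the previous bound the integral over [[a, b]] is Cauchy as soon as
    [H] has limits at both ends, and it cannot exceed the total increase of [H]. *)
Lemma is_int_dominated (f : R -> C) (H h : R -> R) (l0 l1 : R) :
  (forall x, 0 < x -> continuous (T := R_UniformSpace) (U := C_R_NormedModule) f x) ->
  (forall x, 0 < x -> is_derive H x (h x)) ->
  (forall x, 0 < x -> continuous h x) ->
  (forall x, 0 < x -> Cmod (f x) <= h x) ->
  filterlim H (at_right 0) (locally l0) ->
  filterlim H (Rbar_locally p_infty) (locally l1) ->
  exists I, is_int f I /\ Cmod I <= l1 - l0.
Proof.
  intros cf dH ch fh H0 H1.
  assert (hint := is_RInt_gen_of_primitive (V := R_CompleteNormedModule)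
                    H h l0 l1 dH ch H0 H1).
  assert (HI : exists I, is_int f I).
  { apply (filterlimi_locally_cauchy (U := C_R_CompleteNormedModule)
             (F := filter_prod (at_right 0) (Rbar_locally p_infty))
             (fun ab => is_RInt (V := C_R_NormedModule) f (fst ab) (snd ab))).
    - generalize eventually_ends_pos; apply filter_imp; intros [a b] Hab; simpl in *.
      split.
      + destruct (is_RInt_dominated f H h cf dH ch fh a b) as [J [HJ _]]; try lra.
        exists J; exact HJ.
      + intros y1 y2 h1 h2.
        rewrite <- (is_RInt_unique (V := C_R_CompleteNormedModule) _ _ _ _ h1).
        apply (is_RInt_unique (V := C_R_CompleteNormedModule) _ _ _ _ h2).
    - intros eps.
      set (e := pos_div_2 (pos_div_2 eps)).
      exists (fun ab => 0 < fst ab <= snd ab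
                /\ (ball (M := R_UniformSpace) l0 e (H (fst ab))
                /\ ball (M := R_UniformSpace) l1 e (H (snd ab)))).
      split.
      + apply filter_and; [apply eventually_ends_pos|].
        apply filter_and.
        * apply (filterlim_fst (F := at_right 0) (G := Rbar_locally p_infty)
             (fun a => ball (M := R_UniformSpace) l0 e (H a))).
          apply H0. apply locally_ball.
        * apply (filterlim_snd (F := at_right 0) (G := Rbar_locally p_infty)
             (fun a => ball (M := R_UniformSpace) l1 e (H a))).
          apply H1. apply locally_ball.
      + intros [a b] [c d] [Hab [Ha Hb]] [Hcd [Hc Hd]] u v Hu Hv; simpl in *.
        destruct (is_RInt_dominated f H h cf dH ch fh c a) as [J1 [HJ1 BJ1]]; try lra.
        destruct (is_RInt_dominated f H h cf dH ch fh b d) as [J2 [HJ2 BJ2]]; try lra.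
        (* The two integrals differ by those over [[c, a]] and [[b, d]]. *)
        assert (E : v = (J1 + (u + J2))%C).
        { rewrite <- (is_RInt_unique (V := C_R_CompleteNormedModule) _ _ _ _ Hv).
          apply (is_RInt_unique (V := C_R_CompleteNormedModule)).
          apply (is_RInt_Chasles (V := C_R_NormedModule)) with a; [exact HJ1|].
          apply (is_RInt_Chasles (V := C_R_NormedModule)) with b; [exact Hu|exact HJ2]. }
        apply (norm_compat1 (V := C_R_NormedModule)).
        rewrite <- Cmod_norm.
        change (Cmod (v - u)%C < eps).
        replace (v - u)%C with (J1 + J2)%C by (rewrite E; ring).
        eapply Rle_lt_trans; [apply Cmod_triangle|].
        unfold ball in Ha, Hb, Hc, Hd; simpl in Ha, Hb, Hc, Hd.
        unfold AbsRing_ball, abs, minus, plus, opp in Ha, Hb, Hc, Hd.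
        simpl in Ha, Hb, Hc, Hd.
        apply Rabs_def2 in Ha; apply Rabs_def2 in Hb;
        apply Rabs_def2 in Hc; apply Rabs_def2 in Hd.
        assert (Rabs (H a - H c) < eps / 2) by (apply Rabs_def1; lra).
        assert (Rabs (H d - H b) < eps / 2) by (apply Rabs_def1; lra).
        lra. }
  destruct HI as [I HI]. exists I; split; [exact HI|].
  rewrite Cmod_norm.
  apply (RInt_gen_norm (V := C_R_CompleteNormedModule)
     (Fa := at_right 0) (Fb := Rbar_locally p_infty) f h I (l1 - l0)).
  - generalize eventually_ends_pos; apply filter_imp; intros ab Hab; apply Hab.
  - generalize eventually_ends_pos; apply filter_imp; intros ab Hab x Hx.
    rewrite <- Cmod_norm; apply fh; lra.
  - exact HI.
  - exact hint.
Qed.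

Lemma is_RInt_gen_subst {V : CompleteNormedModule R_AbsRing}
    (f : R -> V) (g dg : R -> R) (I : V) :
  (forall x, 0 < x -> continuous f x) ->
  (forall x, 0 < x -> 0 < g x) ->
  (forall x, 0 < x -> is_derive g x (dg x)) ->
  (forall x, 0 < x -> continuous dg x) ->
  filterlim g (at_right 0) (at_right 0) ->
  filterlim g (Rbar_locally p_infty) (Rbar_locally p_infty) ->
  is_RInt_gen f (at_right 0) (Rbar_locally p_infty) I ->
  is_RInt_gen (fun x => scal (dg x) (f (g x))) (at_right 0) (Rbar_locally p_infty) I.
Proof.
  intros cf pg dg' cdg g0 g1 HI P HP.
  specialize (HI P HP). unfold filtermapi in *.
  destruct HI as [Q S HQ HS HQS].
  apply g0 in HQ; apply g1 in HS.
  assert (HQS' : filter_prod (at_right 0) (Rbar_locally p_infty)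
                  (fun ab => Q (g (fst ab)) /\ S (g (snd ab)))).
  { apply Filter_prod with (1 := HQ) (2 := HS). intros a b ha hb; split; assumption. }
  generalize (filter_and _ _ eventually_ends_pos HQS').
  apply filter_imp; intros [a b] [Hab [ha hb]]; simpl in *.
  destruct (HQS _ _ ha hb) as [y [Hy Py]]; simpl in Hy.
  exists y; split; [|exact Py].
  rewrite <- (is_RInt_unique _ _ _ _ Hy).
  apply is_RInt_comp; intros x Hx; rewrite Rmin_left in Hx by lra.
  - apply cf, pg; lra.
  - split; [apply dg' | apply cdg]; lra.
Qed.

Lemma filterlim_Cmult_l (c I : C) :
  filterlim (fun z : C => (c * z)%C) (locally (T := C_R_NormedModule) I)
    (locally (T := C_R_NormedModule) (c * I)%C).
Proof.
  destruct c as [c1 c2].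
    intros Q [eps HQ].
    set (M := 1 + Rabs c1 + Rabs c2).
    assert (hM : 0 < M) by (unfold M; generalize (Rabs_pos c1) (Rabs_pos c2); lra).
    exists (mkposreal _ (Rdiv_lt_0_compat _ _ (cond_pos eps) hM)).
    intros [y1 y2] [h1 h2]. destruct I as [i1 i2].
    unfold ball in h1, h2; simpl in h1, h2.
    unfold AbsRing_ball, abs, minus, plus, opp in h1, h2; simpl in h1, h2.
    assert (B : forall u v s t, Rabs u < eps / M -> Rabs v < eps / M ->
      Rabs s + Rabs t < M -> Rabs (s * u + t * v) < eps).
    { intros u v s t hu hv hst. eapply Rle_lt_trans; [apply Rabs_triang|].
      rewrite !Rabs_mult.
      assert (Rabs s * Rabs u <= Rabs s * (eps / M))
        by (apply Rmult_le_compat_l; [apply Rabs_pos|lra]).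
      assert (Rabs t * Rabs v <= Rabs t * (eps / M))
        by (apply Rmult_le_compat_l; [apply Rabs_pos|lra]).
      assert (E : (Rabs s + Rabs t) * (eps / M) < M * (eps / M)).
      { apply Rmult_lt_compat_r; auto. apply Rdiv_lt_0_compat; auto. apply cond_pos. }
      replace (M * (eps / M)) with (pos eps) in E by (field; lra).
      lra. }
    apply HQ; split; unfold ball; simpl; unfold AbsRing_ball, abs, minus, plus, opp; simpl.
    - replace (c1 * y1 - c2 * y2 + - (c1 * i1 - c2 * i2))
        with (c1 * (y1 + - i1) + (- c2) * (y2 + - i2)) by ring.
      apply B; auto. rewrite Rabs_Ropp; unfold M; lra.
    - replace (c1 * y2 + c2 * y1 + - (c1 * i2 + c2 * i1))
        with (c2 * (y1 + - i1) + c1 * (y2 + - i2)) by ring.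
      apply B; auto. unfold M; lra.
Qed.

(** Real scalars act on the module of values, so a complex factor has to be moved through
    the integral by real and imaginary parts. *)
Lemma is_int_Cmult (f : R -> C) (c I : C) :
  is_int f I -> is_int (fun x => (c * f x)%C) (c * I)%C.
Proof.
  intros HI P HP.
  specialize (HI _ (filterlim_Cmult_l c I P HP)). unfold filtermapi in *.
  revert HI; apply filter_imp; intros [a b] [y [Hy Py]]; simpl in *.
  exists (c * y)%C; split; [|exact Py].
  destruct c as [c1 c2]; destruct y as [y1 y2].
  assert (h1 := is_RInt_fct_extend_fst (U := R_NormedModule) (V := R_NormedModule) _ _ _ _ Hy).
  assert (h2 := is_RInt_fct_extend_snd (U := R_NormedModule) (V := R_NormedModule) _ _ _ _ Hy).
  simpl in h1, h2.
  apply (is_RInt_fct_extend_pair (U := R_NormedModule) (V := R_NormedModule)); simpl.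
  - apply (is_RInt_minus (V := R_NormedModule)); apply (is_RInt_scal (V := R_NormedModule)); assumption.
  - apply (is_RInt_plus (V := R_NormedModule)); apply (is_RInt_scal (V := R_NormedModule)); assumption.
Qed.

Lemma is_int_ext (f g : R -> C) I :
  (forall x, 0 < x -> f x = g x) -> is_int f I -> is_int g I.
Proof.
  intros E. apply is_RInt_gen_ext.
  generalize eventually_ends_pos; apply filter_imp; intros ab Hab x Hx.
  rewrite Rmin_left in Hx by lra. apply E; lra.
Qed.

Lemma is_int_unique (f : R -> C) I J : is_int f I -> is_int f J -> I = J.
Proof.
  intros h1 h2.
  rewrite <- (is_RInt_gen_unique (V := C_R_CompleteNormedModule) _ _ h1).
  apply (is_RInt_gen_unique (V := C_R_CompleteNormedModule) _ _ h2).
Qed.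

Lemma is_int_plus (f g : R -> C) I J :
  is_int f I -> is_int g J -> is_int (fun x => (f x + g x)%C) (I + J)%C.
Proof. intros; apply (is_RInt_gen_plus (V := C_R_NormedModule)); assumption. Qed.

Lemma is_int_minus (f g : R -> C) I J :
  is_int f I -> is_int g J -> is_int (fun x => (f x - g x)%C) (I - J)%C.
Proof. intros; apply (is_RInt_gen_minus (V := C_R_NormedModule)); assumption. Qed.

(** * Complex-valued functions of a real variable *)

Notation contC f x := (continuous (T := R_UniformSpace) (U := C_R_NormedModule) f x).

Lemma continuous_C_pair (f : R -> C) x :
  continuous (fun t => fst (f t)) x -> continuous (fun t => snd (f t)) x ->
  continuous (T := R_UniformSpace) (U := C_R_NormedModule) f x.
Proof.
  intros h1 h2.
  apply (continuous_ext (fun t => (fst (f t), snd (f t)))).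
  { intros t; symmetry; apply surjective_pairing. }
  intros P [eps HP].
  apply (filterlim_pair (F := locally x) (G := locally (fst (f x)))
           (H := locally (snd (f x))) _ _ h1 h2).
  exists (fun u => ball (M := R_UniformSpace) (fst (f x)) eps u)
         (fun u => ball (M := R_UniformSpace) (snd (f x)) eps u);
    try apply locally_ball.
  intros u v hu hv; apply HP; split; assumption.
Qed.

Lemma contC_fst (f : R -> C) x : contC f x -> continuous (fun t => fst (f t)) x.
Proof. intros h; apply (continuous_comp (U := R_UniformSpace) (V := C_R_NormedModule) f fst); [exact h|].
  destruct (f x); apply continuous_fst. Qed.

Lemma contC_snd (f : R -> C) x : contC f x -> continuous (fun t => snd (f t)) x.
Proof. intros h; apply (continuous_comp (U := R_UniformSpace) (V := C_R_NormedModule) f snd); [exact h|].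
  destruct (f x); apply continuous_snd. Qed.

Lemma contC_plus (f g : R -> C) x :
  contC f x -> contC g x -> contC (fun t => (f t + g t)%C) x.
Proof. intros; apply (continuous_plus (V := C_R_NormedModule)); assumption. Qed.

Lemma contC_minus (f g : R -> C) x :
  contC f x -> contC g x -> contC (fun t => (f t - g t)%C) x.
Proof. intros; apply (continuous_minus (V := C_R_NormedModule)); assumption. Qed.

Lemma contC_mult (f g : R -> C) x :
  contC f x -> contC g x -> contC (fun t => (f t * g t)%C) x.
Proof.
  intros h1 h2.
  assert (a1 := contC_fst _ _ h1); assert (a2 := contC_snd _ _ h1).
  assert (b1 := contC_fst _ _ h2); assert (b2 := contC_snd _ _ h2).
  apply continuous_C_pair; simpl.
  - apply (continuous_minus (V := R_NormedModule));
      apply (continuous_mult (K := R_AbsRing)); assumption.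
  - apply (continuous_plus (V := R_NormedModule));
      apply (continuous_mult (K := R_AbsRing)); assumption.
Qed.

Lemma contC_RtoC (f : R -> R) x : continuous f x -> contC (fun t => RtoC (f t)) x.
Proof. intros h; apply continuous_C_pair; simpl; [exact h|apply continuous_const]. Qed.

Lemma contC_const (c : C) x : contC (fun _ => c) x.
Proof. apply continuous_const. Qed.

Lemma contC_Cexp (f : R -> C) x : contC f x -> contC (fun t => Cexp (f t)) x.
Proof.
  intros h.
  assert (a1 := contC_fst _ _ h); assert (a2 := contC_snd _ _ h).
  apply continuous_C_pair; simpl; apply (continuous_mult (K := R_AbsRing)).
  - apply continuous_exp_comp; exact a1.
  - apply continuous_cos_comp; exact a2.
  - apply continuous_exp_comp; exact a1.
  - apply continuous_sin_comp; exact a2.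
Qed.

Lemma contC_pow (f : R -> C) n x : contC f x -> contC (fun t => (f t ^ n)%C) x.
Proof.
  intros h; induction n as [|n IH]; simpl; [apply contC_const|].
  apply contC_mult; assumption.
Qed.

Lemma Cexp_plus z w : Cexp (z + w) = (Cexp z * Cexp w)%C.
Proof.
  unfold Cexp, Cmult, Re, Im; destruct z as [a b], w as [c d]; simpl.
  rewrite exp_plus, cos_plus, sin_plus. f_equal; ring.
Qed.

Lemma Cexp_0 : Cexp 0 = 1%C.
Proof. unfold Cexp; simpl; rewrite exp_0, cos_0, sin_0. unfold RtoC; f_equal; ring. Qed.

Lemma Cexp_RtoC x : Cexp (RtoC x) = RtoC (exp x).
Proof. unfold Cexp, RtoC; simpl; rewrite cos_0, sin_0. f_equal; ring. Qed.

Lemma Cmod_Cexp z : Cmod (Cexp z) = exp (Re z).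
Proof.
  unfold Cmod, Cexp; simpl.
  replace (_ + _) with (Rsqr (exp (Re z))).
  - apply sqrt_Rsqr; left; apply exp_pos.
  - generalize (sin2_cos2 (Im z)); unfold Rsqr; intros E.
    set (e := exp _); transitivity (e * e * (sin (Im z) * sin (Im z) + cos (Im z) * cos (Im z)));
    [rewrite E; ring|ring].
Qed.

Lemma Rabs_sin_le x : Rabs (sin x) <= Rabs x.
Proof.
  assert (P : forall x, 0 <= x -> Rabs (sin x) <= x).
  { intros t [ht|<-]; [|rewrite sin_0, Rabs_R0; lra].
    destruct (Rle_dec t 1) as [h|h].
    - assert (0 < sin t). { apply sin_gt_0; auto. generalize PI_4 PI2_1 PI2_3_2. intros; lra. }
      rewrite Rabs_pos_eq by lra. generalize (sin_lt_x t ht); lra.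
    - generalize (SIN_bound t); intros. apply Rabs_le; lra. }
  unfold Rabs at 2; destruct (Rcase_abs x).
  - rewrite <- Rabs_Ropp, <- sin_neg. apply P; lra.
  - apply P; lra.
Qed.

(** With z = r + i s, this splits e^z - 1 as (e^r - 1) e^(i s) + (e^(i s) - 1), the two
    terms being at most |r| e^|r| and |s|; this accounts for the factor 2. *)
Lemma Cmod_Cexp_sub_1 z : Cmod (Cexp z - 1) <= 2 * Cmod z * exp (Cmod z).
Proof.
  assert (hr := re_le_Cmod z).
  assert (hi : Rabs (Im z) <= Cmod z).
  { eapply Rle_trans; [|apply Rmax_Cmod]. apply Rmax_r. }
  set (m := Cmod z) in *.
  assert (hm : 0 <= m) by apply Cmod_ge_0.
  replace z with (RtoC (Re z) + RtoC (Im z) * Ci)%C at 1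
    by (destruct z; unfold RtoC, Cmult, Cplus, Ci; simpl; f_equal; ring).
  rewrite Cexp_plus, Cexp_RtoC.
  set (e := Cexp (RtoC (Im z) * Ci)).
  assert (E1 : Cmod e = 1).
  { unfold e; rewrite Cmod_Cexp; replace (Re _) with 0 by (simpl; ring). apply exp_0. }
  replace (RtoC (exp (Re z)) * e - 1)%C with (RtoC (exp (Re z) - 1) * e + (e - 1))%C
    by (rewrite RtoC_minus; ring).
  eapply Rle_trans; [apply Cmod_triangle|].
  rewrite Cmod_mult, E1, Cmod_R, Rmult_1_r.
  assert (B1 : Rabs (exp (Re z) - 1) <= m * exp m).
  { apply Rabs_le_between in hr.
    assert (exp (Re z) <= exp m) by (destruct (Req_dec (Re z) m) as [->|]; [lra|left; apply exp_increasing; lra]).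
    generalize (exp_ineq1_le (Re z)) (exp_ineq1_le (- m)) (exp_ineq1_le m); intros h1 h2 h3.
    assert (h4 : exp m * exp (- m) = 1) by (rewrite <- exp_plus; replace (m + - m) with 0 by ring; apply exp_0).
    apply Rabs_le; split.
    - assert (m * 1 <= m * exp m) by (apply Rmult_le_compat_l; lra). lra.
    - assert (exp m * (1 + - m) <= 1) by (rewrite <- h4; apply Rmult_le_compat_l; lra).
      lra. }
  assert (B2 : Cmod (e - 1) <= m).
  { replace e with (cos (Im z), sin (Im z)).
    2:{ unfold e, Cexp; simpl. replace (Im z * 0 - 0 * 1) with 0 by ring.
        replace (Im z * 1 + 0 * 0) with (Im z) by ring. rewrite exp_0; f_equal; ring. }
    unfold Cmod; simpl.
    (* |e^(i s) - 1| = 2 |sin (s / 2)| by the double-angle formulas. *)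
    assert (Ec : cos (Im z) = 1 - 2 * sin (Im z / 2) * sin (Im z / 2)).
    { rewrite <- cos_2a_sin; f_equal; field. }
    assert (Es : sin (Im z) = 2 * sin (Im z / 2) * cos (Im z / 2)).
    { rewrite <- sin_2a; f_equal; field. }
    assert (Esc := sin2_cos2 (Im z / 2)). unfold Rsqr in Esc.
    assert (Bs := Rabs_sin_le (Im z / 2)).
    set (s := sin (Im z / 2)) in *; set (c := cos (Im z / 2)) in *.
    replace (_ + _) with (Rsqr (2 * s)).
    - rewrite sqrt_Rsqr_abs, Rabs_mult, (Rabs_pos_eq 2) by lra.
      unfold Rdiv in Bs; rewrite Rabs_mult, (Rabs_pos_eq (/2)) in Bs by lra. lra.
    - rewrite Ec, Es; unfold Rsqr.
      transitivity (4 * (s * s) * (s * s + c * c)); [rewrite Esc; ring|ring]. }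
  assert (1 <= exp m) by (generalize (exp_ineq1_le m); lra).
  assert (m * 1 <= m * exp m) by (apply Rmult_le_compat_l; lra).
  lra.
Qed.

Lemma is_derive_C_pair (f : R -> C) (l : C) x :
  is_derive (V := R_NormedModule) (fun t => fst (f t)) x (fst l) ->
  is_derive (V := R_NormedModule) (fun t => snd (f t)) x (snd l) ->
  is_derive (V := C_R_NormedModule) f x l.
Proof.
  intros h1 h2.
  apply (is_derive_ext (V := C_R_NormedModule) (fun t => (fst (f t), snd (f t)))).
  { intros t; symmetry; apply surjective_pairing. }
  unfold is_derive in *.
  apply (filterdiff_ext_lin (K := R_AbsRing) (U := AbsRing_NormedModule R_AbsRing)
    (V := C_R_NormedModule) _
    (fun y => (scal y (fst l), scal y (snd l)) : C_R_NormedModule)).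
  2:{ intros y; destruct l; reflexivity. }
  apply (filterdiff_comp'_2 (K := R_AbsRing) (T := AbsRing_NormedModule R_AbsRing)
      (U := R_NormedModule) (V := R_NormedModule) (W := C_R_NormedModule)
      (fun t => fst (f t)) (fun t => snd (f t)) (fun a b => (a, b)) x _ _ (fun a b => (a, b)) h1 h2).
  apply filterdiff_linear.
  split.
  - intros [a b] [c d]; reflexivity.
  - intros k [a b]; reflexivity.
  - exists 1; split; [lra|]. intros [a b]. simpl. rewrite Rmult_1_l. apply Rle_refl.
Qed.

(** All the kernels below are exponentials of this shape, which keeps their derivatives and
    moduli uniform. *)
Lemma is_derive_Cexp_lin (p q : C) (a b : R -> R) (da db x : R) :
  is_derive a x da -> is_derive b x db ->
  is_derive (V := C_R_NormedModule) (fun t => Cexp (p * RtoC (a t) + q * RtoC (b t))) x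
    ((p * RtoC da + q * RtoC db) * Cexp (p * RtoC (a x) + q * RtoC (b x)))%C.
Proof.
  intros ha hb.
  assert (ea : ex_derive a x) by (exists da; exact ha).
  assert (eb : ex_derive b x) by (exists db; exact hb).
  assert (Da : Derive a x = da) by (apply is_derive_unique; exact ha).
  assert (Db : Derive b x = db) by (apply is_derive_unique; exact hb).
  destruct p as [p1 p2], q as [q1 q2].
  apply is_derive_C_pair; simpl.
  - auto_derive; [tauto|].
    change (fun x0 : R => a x0) with a; change (fun x0 : R => b x0) with b.
    rewrite Da, Db. unfold Rminus. ring.
  - auto_derive; [tauto|].
    change (fun x0 : R => a x0) with a; change (fun x0 : R => b x0) with b.
    rewrite Da, Db. unfold Rminus. ring.
Qed.

(** * Domination by powers times exponentials *)

Lemma at_right_pos : at_right 0 (fun x => 0 < x).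
Proof. exists (mkposreal 1 Rlt_0_1); auto. Qed.

Lemma p_infty_pos : Rbar_locally p_infty (fun x => 0 < x).
Proof. exists 0; auto. Qed.

Lemma filterlim_affine_m a b : 0 < a ->
  filterlim (fun y => a * (b + y)) (Rbar_locally m_infty) (Rbar_locally m_infty).
Proof.
  intros ha P [M HM]. exists (M / a - b). intros x hx; apply HM.
  apply Rmult_lt_reg_r with (/ a); [apply Rinv_0_lt_compat; auto|].
  replace (a * (b + x) * / a) with (b + x) by (field; lra). unfold Rdiv in hx; lra.
Qed.

Lemma filterlim_affine_p a b : 0 < a ->
  filterlim (fun y => a * (b + y)) (Rbar_locally p_infty) (Rbar_locally p_infty).
Proof.
  intros ha P [M HM]. exists (M / a - b). intros x hx; apply HM.
  apply Rmult_lt_reg_r with (/ a); [apply Rinv_0_lt_compat; auto|].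
  replace (a * (b + x) * / a) with (b + x) by (field; lra). unfold Rdiv in hx; lra.
Qed.

Lemma filterlim_opp_p : filterlim Ropp (Rbar_locally p_infty) (Rbar_locally m_infty).
Proof. apply (filterlim_Rbar_opp p_infty). Qed.

Lemma lim_exp_m : filterlim exp (Rbar_locally m_infty) (locally 0).
Proof. apply is_lim_exp_m. Qed.

Lemma lim_ln_p : filterlim ln (Rbar_locally p_infty) (Rbar_locally p_infty).
Proof. apply is_lim_ln_p. Qed.

(** Powers of x are written as exponentials of logarithms; the shift [b] accommodates
    x^a scaled by a constant. *)
Lemma power_at_0 a b : 0 < a ->
  filterlim (fun x => exp (a * (b + ln x))) (at_right 0) (locally 0).
Proof.
  intros ha. eapply filterlim_comp; [|apply lim_exp_m].
  eapply (filterlim_comp _ _ _ ln (fun y => a * (b + y))); [apply is_lim_ln_0|].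
  apply filterlim_affine_m; auto.
Qed.

Lemma power_opp_at_infty a b : 0 < a ->
  filterlim (fun x => exp (- (a * (b + ln x)))) (Rbar_locally p_infty) (locally 0).
Proof.
  intros ha. eapply (filterlim_comp _ _ _ (fun x => - (a * (b + ln x))) exp); [|apply lim_exp_m].
  eapply (filterlim_comp _ _ _ _ Ropp); [|apply filterlim_opp_p].
  eapply (filterlim_comp _ _ _ ln (fun y => a * (b + y))); [apply lim_ln_p|].
  apply filterlim_affine_p; auto.
Qed.

Lemma filterlim_cont {F} {FF : Filter F} (f g : R -> R) l l' :
  filterlim f F (locally l) -> continuous g l -> g l = l' ->
  filterlim (fun x => g (f x)) F (locally l').
Proof. intros h1 h2 <-; eapply filterlim_comp; [exact h1|exact h2]. Qed.

Lemma ln_le_sub_1 t : 0 < t -> ln t <= t - 1.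
Proof. intros h. generalize (exp_ineq1_le (ln t)). rewrite exp_ln by auto. lra. Qed.

Lemma exp_le x y : x <= y -> exp x <= exp y.
Proof. intros [h| ->]; [left; apply exp_increasing; auto|lra]. Qed.

(** This is ln (t / s) <= t / s multiplied by s; it says that an exponential absorbs any
    power, with an explicit constant. *)
Lemma mul_ln_le s t : 0 < s -> 0 < t -> s * ln t <= t + s * ln s.
Proof.
  intros hs ht. assert (h := ln_le_sub_1 (t / s) (Rdiv_lt_0_compat _ _ ht hs)).
  unfold Rdiv in h at 1; rewrite ln_mult, ln_Rinv in h; auto using Rinv_0_lt_compat.
  assert (s * (ln t + - ln s) <= s * (t / s - 1)) by (apply Rmult_le_compat_l; lra).
  replace (s * (t / s - 1)) with (t - s) in H by (field; lra). lra.
Qed.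

(** A function bounded by K x^(al - 1) exp (-be x) is integrable, and the bound depends on
    [be] as in int x^(al - 1) exp (-be x) dx = Gamma(al) be^(-al), up to the constant factor.
    The comparison function is the derivative of c P / (1 + P) with P = (be x)^al, which
    increases from 0 to c: it behaves like x^(al - 1) at 0, and at infinity it decays slower
    than any exponential. *)
Lemma is_int_power_exp_bound (al : R) : 0 < al ->
  exists M, 0 <= M /\ forall be K f, 0 < be -> 0 <= K ->
    (forall x, 0 < x -> contC f x) ->
    (forall x, 0 < x -> Cmod (f x) <= K * exp ((al - 1) * ln x - be * x)) ->
    exists I, is_int f I /\ Cmod I <= K * M * exp (- al * ln be).
Proof.
  intros hal.
  (* M0 bounds (1 + P)^2 exp (-be x), as (1 + P)^2 <= 2 + 2 P^2. *)
  set (M0 := 2 + 2 * exp (2 * al * ln (2 * al))).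
  assert (hM0 : 0 < M0) by (unfold M0; generalize (exp_pos (2 * al * ln (2 * al))); lra).
  exists (M0 / al). split; [left; apply Rdiv_lt_0_compat; auto|].
  intros be K f hbe hK cf bf.
  set (c := K * (M0 / al) * exp (- al * ln be)).
  set (P := fun x => exp (al * (ln be + ln x))).
  assert (hP : forall x, 0 < P x) by (intros; apply exp_pos).
  replace c with (c - 0) by ring.
  apply (is_int_dominated f (fun x => c * (1 - / (1 + P x)))
            (fun x => c * (al * P x / x / (1 + P x) ^ 2)) 0 c).
  - exact cf.
  - intros x hx. specialize (hP x). unfold P in *. auto_derive.
    + split; [auto|]. split; auto. lra.
    + field. lra.
  - intros x hx. specialize (hP x).
    apply (ex_derive_continuous (V := R_NormedModule)). unfold P in *. auto_derive.
    repeat split; auto; try lra; try (apply Rgt_not_eq; repeat apply Rmult_lt_0_compat; lra).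
  - intros x hx. eapply Rle_trans; [apply bf; auto|].
    unfold c. rewrite !Rmult_assoc. apply Rmult_le_compat_l; auto.
    assert (E : exp ((al - 1) * ln x - be * x) = exp (- al * ln be) * (P x / x) * exp (- (be * x))).
    { unfold P, Rdiv. rewrite <- (exp_ln x hx) at 4. rewrite <- exp_Ropp, <- !exp_plus.
      f_equal; ring. }
    rewrite E.
    assert (B : (1 + P x) ^ 2 * exp (- (be * x)) <= M0).
    { assert (h1 : P x ^ 2 * exp (- (be * x)) <= exp (2 * al * ln (2 * al))).
      { unfold P; simpl; rewrite Rmult_1_r, <- !exp_plus. apply exp_le.
        rewrite <- ln_mult by auto.
        generalize (mul_ln_le (2 * al) (be * x)). intros h.
        assert (0 < be * x) by (apply Rmult_lt_0_compat; auto). lra. }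
      assert (h2 : exp (- (be * x)) <= 1).
      { rewrite <- exp_0. apply exp_le. assert (0 < be * x) by (apply Rmult_lt_0_compat; auto). lra. }
      assert (h3 : (1 + P x) ^ 2 <= 2 + 2 * P x ^ 2) by (generalize (pow2_ge_0 (1 - P x)); lra).
      assert (h4 := exp_pos (- (be * x))).
      apply Rle_trans with ((2 + 2 * P x ^ 2) * exp (- (be * x))).
      - apply Rmult_le_compat_r; lra.
      - unfold M0. lra. }
    specialize (hP x).
    replace (M0 / al * (exp (- al * ln be) * (al * P x / x / (1 + P x) ^ 2)))
      with (exp (- al * ln be) * (P x / x) * (M0 / (1 + P x) ^ 2))
      by (field; repeat split; lra).
    apply Rmult_le_compat_l.
    + left; repeat apply Rmult_lt_0_compat; auto using exp_pos, Rinv_0_lt_compat.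
    + apply Rmult_le_reg_r with ((1 + P x) ^ 2); [apply pow_lt; lra|].
      replace (M0 / (1 + P x) ^ 2 * (1 + P x) ^ 2) with M0 by (field; lra). lra.
  - apply (filterlim_cont P (fun p => c * (1 - / (1 + p))) 0).
    + apply power_at_0; auto.
    + apply (ex_derive_continuous (V := R_NormedModule)). auto_derive. lra.
    + field.
  - (* Near infinity P / (1 + P) is rewritten as 1 / (1 + 1 / P), where 1 / P tends to 0. *)
    apply (filterlim_ext (fun x => c * / (1 + exp (- (al * (ln be + ln x)))))).
    { intros x. rewrite exp_Ropp. fold (P x). specialize (hP x). field. split; lra. }
    apply (filterlim_cont (fun x => exp (- (al * (ln be + ln x)))) (fun p => c * / (1 + p)) 0).
    + apply power_opp_at_infty; auto.
    + apply (ex_derive_continuous (V := R_NormedModule)). auto_derive. lra.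
    + field.
Qed.

Lemma filterlim_C_0 {F : (R -> Prop) -> Prop} {FF : Filter F} (f : R -> C) (g : R -> R) :
  F (fun x => Cmod (f x) <= g x) -> filterlim g F (locally 0) ->
  filterlim f F (locally (T := C_R_NormedModule) (RtoC 0)).
Proof.
  intros h1 h2.
  apply (filterlim_norm_zero (V := C_R_NormedModule) f).
  apply (filterlim_le_le (fun _ => 0) _ g 0).
  - revert h1; apply filter_imp; intros x hx; rewrite <- Cmod_norm; split; [apply Cmod_ge_0|exact hx].
  - apply filterlim_const.
  - exact h2.
Qed.

(** The boundary terms of the integrations by parts. *)
Lemma power_exp_vanishes (al be K : R) (F : R -> C) : 0 < al -> 0 < be ->
  (forall x, 0 < x -> Cmod (F x) <= K * exp (al * ln x - be * x)) ->
  filterlim F (at_right 0) (locally (T := C_R_NormedModule) (RtoC 0)) /\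
  filterlim F (Rbar_locally p_infty) (locally (T := C_R_NormedModule) (RtoC 0)).
Proof.
  intros hal hbe bF.
  assert (hK : 0 <= K).
  { specialize (bF 1 Rlt_0_1). generalize (Cmod_ge_0 (F 1)) (exp_pos (al * ln 1 - be * 1)).
    intros. apply Rmult_le_reg_r with (exp (al * ln 1 - be * 1)); lra. }
  split.
  - apply (filterlim_C_0 F (fun x => K * exp (al * (0 + ln x)))).
    + generalize at_right_pos; apply filter_imp; intros x hx.
      eapply Rle_trans; [apply bF; auto|]. apply Rmult_le_compat_l; auto. apply exp_le.
      assert (0 < be * x) by (apply Rmult_lt_0_compat; auto). lra.
    + apply (filterlim_cont _ (fun y => K * y) 0); [apply power_at_0; auto| |ring].
      apply (ex_derive_continuous (V := R_NormedModule)). auto_derive; auto.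
  - set (s := 2 * al / be).
    assert (hs : 0 < s) by (unfold s; apply Rdiv_lt_0_compat; lra).
    (* Half of the exponential decay absorbs the power x^al. *)
    apply (filterlim_C_0 F (fun x => K * exp (be / 2 * (s * ln s + - x)))).
    + generalize p_infty_pos; apply filter_imp; intros x hx.
      eapply Rle_trans; [apply bF; auto|]. apply Rmult_le_compat_l; auto. apply exp_le.
      assert (h := mul_ln_le s x hs hx).
      assert (be / 2 * (s * ln x) <= be / 2 * (x + s * ln s)) by (apply Rmult_le_compat_l; lra).
      replace (be / 2 * (s * ln x)) with (al * ln x) in H by (unfold s; field; lra). lra.
    + apply (filterlim_cont _ (fun y => K * y) 0); [| |ring].
      2: { apply (ex_derive_continuous (V := R_NormedModule)). auto_derive; auto. }
      eapply filterlim_comp; [|apply lim_exp_m].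
      eapply (filterlim_comp _ _ _ Ropp (fun y => be / 2 * (s * ln s + y))); [apply filterlim_opp_p|].
      apply filterlim_affine_m; lra.
Qed.

Lemma is_int_derive (F f : R -> C) (l0 l1 : C) :
  (forall x, 0 < x -> is_derive (V := C_R_NormedModule) F x (f x)) ->
  (forall x, 0 < x -> contC f x) ->
  filterlim F (at_right 0) (locally (T := C_R_NormedModule) l0) ->
  filterlim F (Rbar_locally p_infty) (locally (T := C_R_NormedModule) l1) ->
  is_int f (l1 - l0)%C.
Proof. apply (is_RInt_gen_of_primitive (V := C_R_CompleteNormedModule)). Qed.

(** * The Gamma and Beta integrals *)

(** After the substitution u = exp (-x) in Euler's Beta integral, ln u is -x and
    ln (1 - u) is this function. *)
Definition ln_1_exp (x : R) : R := ln (1 - exp (- x)).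

Lemma one_minus_exp_pos x : 0 < x -> 0 < 1 - exp (- x).
Proof. intros hx. assert (exp (- x) < exp 0) by (apply exp_increasing; lra). rewrite exp_0 in H; lra. Qed.

(** From x exp (-x) <= 1 - exp (-x) <= x. *)
Lemma ln_1_exp_bounds x : 0 < x -> - x <= ln_1_exp x - ln x <= 0.
Proof.
  intros hx. assert (hp := one_minus_exp_pos x hx). unfold ln_1_exp.
  split.
  - assert (ln x - x <= ln (1 - exp (- x))); [|lra].
    replace (ln x - x) with (ln (x * exp (- x))) by (rewrite ln_mult, ln_exp; auto using exp_pos; ring).
    apply ln_le; [apply Rmult_lt_0_compat; auto using exp_pos|].
    assert (h := exp_ineq1_le x).
    assert (h4 : exp x * exp (- x) = 1) by (rewrite <- exp_plus; replace (x + - x) with 0 by ring; apply exp_0).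
    assert ((1 + x) * exp (- x) <= exp x * exp (- x)) by (apply Rmult_le_compat_r; auto; left; apply exp_pos).
    lra.
  - assert (ln (1 - exp (- x)) <= ln x); [|lra].
    apply ln_le; auto. generalize (exp_ineq1_le (- x)); lra.
Qed.

(** The lower bound -x of [ln_1_exp_bounds] would cost an exponential factor of fixed rate
    in the Beta kernel when Re q < 1, possibly more than its decay; from
    1 - exp (-x) >= x / (1 + x) the loss is only exp (e x) with [e] as small as desired. *)
Lemma ln_1_exp_lower x e : 0 < x -> 0 < e <= 1 -> - (e * x - ln e) <= ln_1_exp x - ln x.
Proof.
  intros hx he. assert (hp := one_minus_exp_pos x hx). unfold ln_1_exp.
  assert (h1 : ln (x / (1 + x)) <= ln (1 - exp (- x))).
  { apply ln_le; [apply Rdiv_lt_0_compat; lra|].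
    assert (h := exp_ineq1_le x).
    assert (exp (- x) <= / (1 + x)) by (rewrite exp_Ropp; apply Rinv_le_contravar; lra).
    replace (x / (1 + x)) with (1 - / (1 + x)) by (field; lra). lra. }
  assert (h2 : ln (e * (1 + x)) <= e * x).
  { rewrite <- (ln_exp (e * x)). apply ln_le; [apply Rmult_lt_0_compat; lra|].
    generalize (exp_ineq1_le (e * x)); lra. }
  unfold Rdiv in h1; rewrite ln_mult, ln_Rinv in h1; try lra; [|apply Rinv_0_lt_compat; lra].
  rewrite ln_mult in h2 by lra. lra.
Qed.

(** The kernel exp (-p x) (1 - exp (-x))^(q - 1), so that [beta_int p q] below is
    int_0^1 u^(p - 1) (1 - u)^(q - 1) du after u = exp (-x). *)
Definition beta_kernel (p q : C) (x : R) : C :=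
  Cexp (- p * RtoC x + (q - 1) * RtoC (ln_1_exp x)).

Definition gamma_kernel (z : C) (x : R) : C :=
  Cexp ((z - 1) * RtoC (ln x) + - (1) * RtoC x).

Lemma is_derive_ln_1_exp x : 0 < x -> is_derive ln_1_exp x (exp (- x) / (1 - exp (- x))).
Proof.
  intros hx. assert (hp := one_minus_exp_pos x hx). unfold ln_1_exp.
  auto_derive; [lra|]. field; lra.
Qed.

Lemma continuous_ln x : 0 < x -> continuous ln x.
Proof. intros; apply (ex_derive_continuous (V := R_NormedModule)). auto_derive; auto. Qed.

Lemma continuous_ln_1_exp x : 0 < x -> continuous ln_1_exp x.
Proof. intros; apply (ex_derive_continuous (V := R_NormedModule)).
  eexists; apply is_derive_ln_1_exp; auto. Qed.

Lemma contC_Cexp_lin (p q : C) (a b : R -> R) x :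
  continuous a x -> continuous b x -> contC (fun t => Cexp (p * RtoC (a t) + q * RtoC (b t))) x.
Proof.
  intros. apply contC_Cexp, contC_plus; apply contC_mult; try apply contC_const;
  apply contC_RtoC; auto.
Qed.

Lemma contC_beta_kernel p q x : 0 < x -> contC (beta_kernel p q) x.
Proof.
  intros; apply (contC_Cexp_lin (- p)%C (q - 1)%C (fun t => t)); [apply continuous_id|].
  apply continuous_ln_1_exp; auto.
Qed.

Lemma contC_gamma_kernel z x : 0 < x -> contC (gamma_kernel z) x.
Proof.
  intros; apply (contC_Cexp_lin (z - 1)%C (- (1))%C ln (fun t => t)); [|apply continuous_id].
  apply continuous_ln; auto.
Qed.

Lemma beta_kernel_bound p q : 0 < Re p ->
  exists K, 0 <= K /\ forall x, 0 < x ->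
   Cmod (beta_kernel p q x) <= K * exp ((Re q - 1) * ln x - Re p / 2 * x).
Proof.
  intros hp.
  (* The rate e is chosen with |Re q - 1| e <= Re p / 2, half of the available decay. *)
  set (s := Rabs (Re q - 1)).
  assert (hs : 0 <= s) by apply Rabs_pos.
  set (e := Rmin 1 (Re p / (2 * (s + 1)))).
  assert (he0 : 0 < Re p / (2 * (s + 1))) by (apply Rdiv_lt_0_compat; lra).
  assert (he : 0 < e <= 1).
  { unfold e; split; [apply Rmin_glb_lt; lra|apply Rmin_l]. }
  assert (hse : s * e <= Re p / 2).
  { apply Rle_trans with (s * (Re p / (2 * (s + 1)))).
    - apply Rmult_le_compat_l; auto. apply Rmin_r.
    - replace (s * (Re p / (2 * (s + 1)))) with (Re p / 2 * (s / (s + 1))) by (field; lra).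
      rewrite <- (Rmult_1_r (Re p / 2)) at 2. apply Rmult_le_compat_l; [lra|].
      apply Rmult_le_reg_r with (s + 1); [lra|]. unfold Rdiv; rewrite Rmult_assoc, Rinv_l by lra. lra. }
  exists (exp (- s * ln e)). split; [left; apply exp_pos|].
  intros x hx. unfold beta_kernel. rewrite Cmod_Cexp, <- exp_plus. apply exp_le.
  assert (hb := ln_1_exp_bounds x hx). assert (hl := ln_1_exp_lower x e hx he).
  set (L := ln_1_exp x - ln x) in *.
  replace (Re (- p * x + (q - 1) * RtoC (ln_1_exp x))) with (- Re p * x + (Re q - 1) * (L + ln x))
    by (unfold L; destruct p, q; simpl; ring).
  assert (h1 : (Re q - 1) * L <= s * (e * x - ln e)).
  { apply Rle_trans with (Rabs (Re q - 1) * Rabs L).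
    - rewrite <- Rabs_mult. apply Rle_abs.
    - fold s. apply Rmult_le_compat_l; auto. rewrite Rabs_left1; lra. }
  assert (s * e * x <= Re p / 2 * x) by (apply Rmult_le_compat_r; lra).
  lra.
Qed.

Definition beta_int (p q : C) : C :=
  RInt_gen (V := C_R_CompleteNormedModule) (beta_kernel p q) (at_right 0) (Rbar_locally p_infty).

Lemma is_int_RInt_gen (f : R -> C) : (exists I, is_int f I) ->
  is_int f (RInt_gen (V := C_R_CompleteNormedModule) f (at_right 0) (Rbar_locally p_infty)).
Proof.
  intros [I HI]. rewrite (is_RInt_gen_unique (V := C_R_CompleteNormedModule) _ _ HI). exact HI.
Qed.

Lemma is_int_beta p q : 0 < Re p -> 0 < Re q -> is_int (beta_kernel p q) (beta_int p q).
Proof.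
  intros hp hq. apply is_int_RInt_gen.
  destruct (beta_kernel_bound p q hp) as [K [hK bK]].
  destruct (is_int_power_exp_bound (Re q) hq) as [M [hM HM]].
  destruct (HM (Re p / 2) K (beta_kernel p q)) as [I [HI _]]; auto.
  - lra.
  - intros; apply contC_beta_kernel; auto.
  - exists I; exact HI.
Qed.

Lemma Euler_kernel z t : 0 < t -> (Rcpow t (z - 1) * RtoC (exp (- t)))%C = gamma_kernel z t.
Proof.
  intros ht. unfold gamma_kernel, Rcpow. rewrite Cexp_plus, <- Cexp_RtoC, RtoC_opp. do 2 f_equal. ring.
Qed.

Lemma Cmod_gamma_kernel z x : Cmod (gamma_kernel z x) = exp ((Re z - 1) * ln x - 1 * x).
Proof. unfold gamma_kernel; rewrite Cmod_Cexp; f_equal; destruct z; simpl; ring. Qed.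

Lemma is_int_gamma z : 0 < Re z -> is_int (gamma_kernel z) (Euler_Gamma z).
Proof.
  intros hz.
  apply (is_int_ext (fun t => (Rcpow t (z - 1) * RtoC (exp (- t)))%C)).
  { intros; apply Euler_kernel; auto. }
  unfold Euler_Gamma. apply is_int_RInt_gen.
  destruct (is_int_power_exp_bound (Re z) hz) as [M [hM HM]].
  destruct (HM 1 1 (gamma_kernel z)) as [I [HI _]]; try lra.
  - intros; apply contC_gamma_kernel; auto.
  - intros; rewrite Cmod_gamma_kernel; lra.
  - exists I. apply is_int_ext with (2 := HI). intros; symmetry; apply Euler_kernel; auto.
Qed.

(** Integration by parts: t^z exp (-t) vanishes at both ends, and its derivative is the
    difference of the two kernels. *)
Lemma Euler_Gamma_succ z : 0 < Re z -> Euler_Gamma (z + 1) = (z * Euler_Gamma z)%C.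
Proof.
  intros hz.
  assert (h1 := is_int_Cmult _ z _ (is_int_gamma z hz)).
  assert (hz' : 0 < Re (z + 1)) by (rewrite ?re_plus, re_RtoC; lra).
  assert (h2 := is_int_minus _ _ _ _ h1 (is_int_gamma (z + 1) hz')).
  set (F := fun t => Cexp (z * RtoC (ln t) + - (1) * RtoC t)).
  destruct (power_exp_vanishes (Re z) 1 1 F) as [F0 F1]; try lra.
  { intros x hx. unfold F. rewrite Cmod_Cexp, Rmult_1_l. apply exp_le.
    right. destruct z; simpl; ring. }
  assert (h3 := is_int_derive F (fun x => (z * gamma_kernel z x - gamma_kernel (z + 1) x)%C) 0 0).
  enough (E : (z * Euler_Gamma z - Euler_Gamma (z + 1))%C = (0 - 0)%C).
  { transitivity (z * Euler_Gamma z - (z * Euler_Gamma z - Euler_Gamma (z + 1)))%C; [ring|].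
    rewrite E; ring. }
  eapply is_int_unique; [exact h2|]. apply h3; auto.
  - intros x hx.
    assert (D := is_derive_Cexp_lin z (- (1)) ln (fun t => t) (/ x) 1 x).
    replace (z * gamma_kernel z x - gamma_kernel (z + 1) x)%C with
      ((z * RtoC (/ x) + - (1) * RtoC 1) * Cexp (z * RtoC (ln x) + - (1) * RtoC x))%C.
    + apply D; auto_derive; auto. field; lra.
    + unfold gamma_kernel.
      replace ((z + 1 - 1) * RtoC (ln x) + - (1) * x)%C with (z * RtoC (ln x) + - (1) * x)%C by ring.
      replace ((z - 1) * RtoC (ln x) + - (1) * x)%C
        with ((z * RtoC (ln x) + - (1) * x) + RtoC (- ln x))%C by (rewrite RtoC_opp; ring).
      rewrite (Cexp_plus _ (RtoC _)), Cexp_RtoC, exp_Ropp, exp_ln by auto. ring.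
  - intros x hx. apply contC_minus; [apply contC_mult; [apply contC_const|]|];
    apply contC_gamma_kernel; auto.
Qed.

(** The primitive exp (-p x) (1 - exp (-x))^q behind both [beta_int_succ] and
    [beta_int_1_l]; its derivative
    -p exp (-p x) (1 - exp (-x))^q + q exp (-(p+1) x) (1 - exp (-x))^(q-1) is put in terms of
    Beta kernels by expanding one factor 1 - exp (-x). *)
Lemma is_derive_beta_primitive p q x : 0 < x ->
  is_derive (V := C_R_NormedModule) (beta_kernel p (q + 1)) x
    ((p + q) * beta_kernel (p + 1) q x - p * beta_kernel p q x)%C.
Proof.
  intros hx. assert (hp := one_minus_exp_pos x hx).
  assert (D := is_derive_Cexp_lin (- p) (q + 1 - 1) (fun t => t) ln_1_exp 1
     (exp (- x) / (1 - exp (- x))) x).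
  replace (((p + q) * beta_kernel (p + 1) q x - p * beta_kernel p q x)%C) with
    ((- p * RtoC 1 + (q + 1 - 1) * RtoC (exp (- x) / (1 - exp (- x)))) *
        Cexp (- p * RtoC x + (q + 1 - 1) * RtoC (ln_1_exp x)))%C.
  - apply D; [auto_derive; auto|]. apply is_derive_ln_1_exp; auto.
  - unfold beta_kernel.
    replace (- p * RtoC x + (q + 1 - 1) * RtoC (ln_1_exp x))%C
      with ((- p * RtoC x + (q - 1) * RtoC (ln_1_exp x)) + RtoC (ln_1_exp x))%C by ring.
    replace (- (p + 1) * RtoC x + (q - 1) * RtoC (ln_1_exp x))%C
      with ((- p * RtoC x + (q - 1) * RtoC (ln_1_exp x)) + RtoC (- x))%C by (rewrite RtoC_opp; ring).
    rewrite !(Cexp_plus _ (RtoC _)), !Cexp_RtoC. unfold ln_1_exp at 2. rewrite exp_ln by auto.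
    set (E := Cexp _).
    assert (hc : RtoC (1 - exp (- x)) <> 0%C) by (intros h; apply RtoC_inj in h; lra).
    rewrite RtoC_div by lra. rewrite RtoC_minus in *. field. exact hc.
Qed.

Lemma beta_int_succ p q : 0 < Re p -> 0 < Re q ->
  (p * beta_int p q)%C = ((p + q) * beta_int (p + 1) q)%C.
Proof.
  intros hp hq.
  assert (hp1 : 0 < Re (p + 1)) by (rewrite ?re_plus, re_RtoC; lra).
  assert (h2 := is_int_minus _ _ _ _
    (is_int_Cmult _ (p + q)%C _ (is_int_beta (p + 1) q hp1 hq))
    (is_int_Cmult _ p _ (is_int_beta p q hp hq))).
  destruct (power_exp_vanishes (Re q) (Re p) 1 (beta_kernel p (q + 1))) as [F0 F1]; try lra.
  { intros x hx. unfold beta_kernel. rewrite Cmod_Cexp, Rmult_1_l. apply exp_le.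
    assert (hb := ln_1_exp_bounds x hx).
    replace (Re (- p * x + (q + 1 - 1) * RtoC (ln_1_exp x)))
      with (- Re p * x + Re q * ln_1_exp x) by (destruct p, q; simpl; ring).
    assert (Re q * ln_1_exp x <= Re q * ln x) by (apply Rmult_le_compat_l; lra). lra. }
  enough (E : ((p + q) * beta_int (p + 1) q - p * beta_int p q)%C = (0 - 0)%C).
  { transitivity ((p + q) * beta_int (p + 1) q - ((p + q) * beta_int (p + 1) q - p * beta_int p q))%C; [ring|].
    rewrite E; ring. }
  eapply is_int_unique; [exact h2|].
  apply (is_int_derive (beta_kernel p (q + 1))); auto.
  - intros; apply is_derive_beta_primitive; auto.
  - intros x hx. apply contC_minus; (apply contC_mult; [apply contC_const|]);
    apply contC_beta_kernel; auto.
Qed.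

(** The case p = 0 of the same primitive, which then tends to 1 at infinity. *)
Lemma beta_int_1_l q : 0 < Re q -> (q * beta_int 1 q)%C = 1%C.
Proof.
  intros hq.
  assert (hp1 : 0 < Re 1) by (rewrite ?re_plus, re_RtoC; lra).
  assert (h2 := is_int_Cmult _ q _ (is_int_beta 1 q hp1 hq)).
  replace (RtoC 1) with (1 - 0)%C at 2 by ring.
  eapply is_int_unique; [exact h2|].
  apply (is_int_derive (beta_kernel 0 (q + 1))).
  - intros x hx.
    replace (q * beta_kernel 1 q x)%C with
      ((0 + q) * beta_kernel (0 + 1) q x - 0 * beta_kernel 0 q x)%C.
    + apply is_derive_beta_primitive; auto.
    + rewrite !Cplus_0_l; ring.
  - intros x hx. apply contC_mult; [apply contC_const|]. apply contC_beta_kernel; auto.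
  - apply (filterlim_C_0 _ (fun x => exp (Re q * (0 + ln x)))).
    + generalize at_right_pos; apply filter_imp; intros x hx.
      unfold beta_kernel; rewrite Cmod_Cexp. apply exp_le.
      assert (hb := ln_1_exp_bounds x hx).
      replace (Re (- 0 * x + (q + 1 - 1) * RtoC (ln_1_exp x)))
        with (Re q * ln_1_exp x) by (destruct q; simpl; ring).
      rewrite Rplus_0_l. apply Rmult_le_compat_l; lra.
    + apply power_at_0; auto.
  - assert (E1 : Cexp (q * RtoC (ln (1 - 0))) = 1%C)
      by (rewrite Rminus_0_r, ln_1, Cmult_0_r; apply Cexp_0).
    apply (filterlim_filter_le_2 (G := locally (T := C_R_NormedModule)
       (Cexp (q * RtoC (ln (1 - 0)))))).
    { rewrite E1. apply filter_le_refl. }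
    apply (filterlim_ext (fun x => Cexp (q * RtoC (ln (1 - exp (- x)))))).
    { intros x. unfold beta_kernel, ln_1_exp. f_equal. ring. }
    apply (filterlim_comp _ _ _ (fun x => exp (- x)) (fun u => Cexp (q * RtoC (ln (1 - u)))) _ (locally 0)).
    + eapply filterlim_comp; [apply filterlim_opp_p|apply lim_exp_m].
    + apply (contC_Cexp (fun u => q * RtoC (ln (1 - u)))%C 0).
      apply contC_mult; [apply contC_const|]. apply contC_RtoC.
      apply (ex_derive_continuous (V := R_NormedModule)). auto_derive. lra.
Qed.

(** * The Beta integral as a quotient of Gamma values *)

(** The Laplace transform of x^(q - 1), from the Gamma integral by scaling. *)
Lemma is_int_scaled_gamma q N : 0 < Re q -> 0 < N ->
  is_int (fun x => Cexp (- RtoC N * RtoC x + (q - 1) * RtoC (ln x)))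
    (Cexp (- q * RtoC (ln N)) * Euler_Gamma q)%C.
Proof.
  intros hq hN.
  assert (h := is_RInt_gen_subst (V := C_R_CompleteNormedModule) (gamma_kernel q)
     (fun x => N * x) (fun _ => N) (Euler_Gamma q)).
  apply (is_int_ext (fun x => (Cexp (- q * RtoC (ln N)) * scal N (gamma_kernel q (N * x)%R))%C)).
  { intros x hx.
    rewrite scal_R_Cmult. unfold gamma_kernel. rewrite ln_mult by auto.
    rewrite <- (exp_ln N hN) at 2. rewrite <- Cexp_RtoC, <- !Cexp_plus.
    f_equal. rewrite RtoC_plus, RtoC_mult. ring. }
  apply is_int_Cmult. apply h.
  - intros; apply contC_gamma_kernel; auto.
  - intros; apply Rmult_lt_0_compat; auto.
  - intros; auto_derive; auto; ring.
  - intros; apply continuous_const.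
  - intros P [eps HP].
    exists (mkposreal _ (Rdiv_lt_0_compat _ _ (cond_pos eps) hN)).
    intros y hy py. apply HP; [|apply Rmult_lt_0_compat; auto].
    unfold ball in *; simpl in *; unfold AbsRing_ball, abs, minus, plus, opp in *; simpl in *.
    apply Rabs_def2 in hy. rewrite Ropp_0, Rplus_0_r in *.
    assert (N * y < N * (eps / N)) by (apply Rmult_lt_compat_l; lra).
    replace (N * (eps / N)) with (pos eps) in H by (field; lra).
    rewrite Rabs_pos_eq; auto. left; apply Rmult_lt_0_compat; auto.
  - intros P HP. assert (a := filterlim_affine_p N 0 hN P HP). unfold filtermap in *.
    revert a; apply filter_imp; intros; rewrite <- (Rplus_0_l x); auto.
  - apply is_int_gamma; auto.
Qed.

Lemma Re_opp z : Re (- z) = - Re z.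
Proof. reflexivity. Qed.

(** Normalized so as to tend to Gamma(q) as N grows. *)
Definition beta_scaled (p q : C) (N : R) : C :=
  (Cexp (q * RtoC (ln N)) * beta_int (p + RtoC N) q)%C.

(** With L = ln ((1 - exp (-x)) / x), which lies between -x and 0, the kernel of B(p + N, q)
    is exp (-N x) x^(q - 1) times exp (-p x + (q - 1) L), and the last factor is
    1 + O(x exp (M x)).  So the difference to the kernel of N^(-q) Gamma(q) is dominated by
    x^Re q exp (-(N - M) x), whose integral is of order N^(-Re q - 1). *)
Lemma beta_scaled_close p q : 0 < Re q ->
  exists K N0, 0 < N0 /\ forall N, N0 <= N ->
    Cmod (beta_scaled p q N - Euler_Gamma q) <= K / N.
Proof.
  intros hq.
  set (M := Cmod p + Cmod (q - 1)).
  assert (hM : 0 <= M) by (unfold M; generalize (Cmod_ge_0 p) (Cmod_ge_0 (q - 1)); lra).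
  destruct (is_int_power_exp_bound (Re q + 1)) as [B [hB HB]]; [lra|].
  (* For N >= 2 M one has N - M >= N / 2, which gives the power of 2 in the constant. *)
  exists (2 * M * B * exp ((Re q + 1) * ln 2)), (2 * M + 1). split; [lra|].
  intros N hN.
  assert (hN0 : 0 < N) by lra.
  assert (hpN : 0 < Re (p + RtoC N)).
  { rewrite re_plus, re_RtoC. generalize (re_le_Cmod p) (Cmod_ge_0 (q - 1)). intros h1 h2.
    apply Rabs_le_between in h1. unfold M in *. lra. }
  assert (h1 := is_int_minus _ _ _ _ (is_int_beta _ q hpN hq) (is_int_scaled_gamma q N hq hN0)).
  simpl in h1.
  destruct (HB (N - M) (2 * M)
    (fun x => (beta_kernel (p + RtoC N) q x - Cexp (- RtoC N * RtoC x + (q - 1) * RtoC (ln x)))%C))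
    as [I [HI BI]].
  - lra.
  - lra.
  - intros x hx. apply contC_minus; [apply contC_beta_kernel; auto|].
    apply (contC_Cexp_lin _ _ (fun t => t)); [apply continuous_id|apply continuous_ln; auto].
  - intros x hx. assert (hb := ln_1_exp_bounds x hx).
    set (L := ln_1_exp x - ln x) in *.
    set (z := (- p * RtoC x + (q - 1) * RtoC L)%C).
    replace (beta_kernel (p + RtoC N) q x - Cexp (- RtoC N * RtoC x + (q - 1) * RtoC (ln x)))%C
      with (Cexp (- RtoC N * RtoC x + (q - 1) * RtoC (ln x)) * (Cexp z - 1))%C.
    2:{ unfold beta_kernel.
        replace (- (p + N) * x + (q - 1) * RtoC (ln_1_exp x))%C with
         ((- RtoC N * RtoC x + (q - 1) * RtoC (ln x)) + z)%C
         by (unfold z, L; rewrite RtoC_minus; ring).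
        rewrite (Cexp_plus _ z). ring. }
    rewrite Cmod_mult, Cmod_Cexp.
    assert (hz : Cmod z <= M * x).
    { unfold z. eapply Rle_trans; [apply Cmod_triangle|].
      rewrite !Cmod_mult, Cmod_opp, !Cmod_R, (Rabs_pos_eq x), (Rabs_left1 L) by lra.
      assert (Cmod (q - 1) * - L <= Cmod (q - 1) * x)
        by (apply Rmult_le_compat_l; [apply Cmod_ge_0|lra]).
      unfold M. lra. }
    assert (hz2 := Cmod_Cexp_sub_1 z).
    assert (hz3 := Cmod_ge_0 z).
    replace (Re (- RtoC N * x + (q - 1) * RtoC (ln x))) with ((Re q - 1) * ln x - N * x)
      by (destruct q; simpl; ring).
    apply Rle_trans with (exp ((Re q - 1) * ln x - N * x) * (2 * (M * x) * exp (M * x))).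
    + apply Rmult_le_compat_l; [left; apply exp_pos|].
      eapply Rle_trans; [exact hz2|].
      apply Rmult_le_compat; try lra; [left; apply exp_pos|apply exp_le; lra].
    + right. rewrite <- (exp_ln x hx) at 3.
      transitivity (2 * M * (exp ((Re q - 1) * ln x - N * x) * exp (ln x) * exp (M * x))); [ring|].
      rewrite <- !exp_plus. do 2 f_equal. ring.
  - assert (E := is_int_unique _ _ _ HI h1). rewrite E in BI.
    assert (E2 : (beta_scaled p q N - Euler_Gamma q)%C =
       (Cexp (q * RtoC (ln N)) * (beta_int (p + N) q - Cexp (- q * RtoC (ln N)) * Euler_Gamma q))%C).
    { unfold beta_scaled.
      assert (E3 : (Cexp (q * RtoC (ln N)) * Cexp (- q * RtoC (ln N)) = 1)%C).
      { rewrite <- Cexp_plus, <- Cexp_0. f_equal. ring. }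
      transitivity (Cexp (q * RtoC (ln N)) * beta_int (p + N) q -
         (Cexp (q * RtoC (ln N)) * Cexp (- q * RtoC (ln N))) * Euler_Gamma q)%C; [rewrite E3|]; ring. }
    rewrite E2, Cmod_mult, Cmod_Cexp.
    replace (Re (q * RtoC (ln N))) with (Re q * ln N) by (destruct q; simpl; ring).
    eapply Rle_trans.
    { apply Rmult_le_compat_l; [left; apply exp_pos|exact BI]. }
    assert (hl : ln N - ln 2 <= ln (N - M)).
    { rewrite <- ln_div by lra. apply ln_le; [lra|]. lra. }
    apply Rle_trans with (exp (Re q * ln N) * (2 * M * B * exp (- (Re q + 1) * (ln N - ln 2)))).
    + apply Rmult_le_compat_l; [left; apply exp_pos|].
      apply Rmult_le_compat_l; [repeat apply Rmult_le_pos; lra|].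
      apply exp_le. apply Rmult_le_compat_neg_l; lra.
    + right. unfold Rdiv. rewrite <- (exp_ln N) at 3 by auto. rewrite <- exp_Ropp.
      transitivity (2 * M * B * (exp (Re q * ln N) * exp (- (Re q + 1) * (ln N - ln 2)))); [ring|].
      rewrite <- exp_plus, (Rmult_assoc (2 * M * B)), <- exp_plus. do 2 f_equal. ring.
Qed.

Lemma rising_succ_l q n : (q * rising (q + 1) n)%C = rising q (S n).
Proof.
  induction n as [|n IH]; [simpl; ring|].
  change (rising (q + 1) (S n)) with (rising (q + 1) n * (q + 1 + RtoC (INR n)))%C.
  change (rising q (S (S n))) with (rising q (S n) * (q + RtoC (INR (S n))))%C.
  rewrite <- IH, S_INR, RtoC_plus. ring.
Qed.

Lemma rising_1 n : rising 1 n = RtoC (INR (fact n)).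
Proof.
  induction n as [|n IH]; [reflexivity|].
  change (rising 1 (S n)) with (rising 1 n * (1 + RtoC (INR n)))%C.
  rewrite IH, fact_simpl, mult_INR, S_INR, RtoC_mult, RtoC_plus. ring.
Qed.

Lemma beta_int_rising p q n : 0 < Re p -> 0 < Re q ->
  (rising p n * beta_int p q = rising (p + q) n * beta_int (p + RtoC (INR n)) q)%C.
Proof.
  intros hp hq. induction n as [|n IH].
  - simpl. rewrite Cplus_0_r. reflexivity.
  - simpl rising.
    assert (hn : 0 < Re (p + RtoC (INR n))).
    { rewrite re_plus, re_RtoC. generalize (pos_INR n); lra. }
    assert (E := beta_int_succ _ q hn hq).
    transitivity ((p + RtoC (INR n)) * (rising p n * beta_int p q))%C; [ring|].
    rewrite IH. rewrite S_INR, RtoC_plus.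
    transitivity (rising (p + q) n * ((p + RtoC (INR n)) * beta_int (p + RtoC (INR n)) q))%C; [ring|].
    rewrite E.
    replace (p + (RtoC (INR n) + 1))%C with (p + RtoC (INR n) + 1)%C by ring. ring.
Qed.

(** Iterating [beta_int_succ] from B(1, q) = 1 / q. *)
Lemma beta_int_nat q m : 0 < Re q ->
  (rising q (S m) * beta_int (RtoC (INR (S m))) q)%C = RtoC (INR (fact m)).
Proof.
  intros hq.
  assert (h1 : 0 < Re 1) by (rewrite re_RtoC; lra).
  assert (E := beta_int_rising 1 q m h1 hq). rewrite rising_1 in E.
  rewrite S_INR, RtoC_plus, (Cplus_comm (RtoC (INR m))), <- rising_succ_l.
  rewrite (Cplus_comm q).
  transitivity (q * (rising (1 + q) m * beta_int (1 + RtoC (INR m)) q))%C; [ring|].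
  rewrite <- E.
  transitivity (RtoC (INR (fact m)) * (q * beta_int 1 q))%C; [ring|].
  rewrite (beta_int_1_l q hq). ring.
Qed.

(** From |1 + q / k|^2 = 1 + 2 Re q / k + |q|^2 / k^2 and 1 + u <= exp u. *)
Lemma Cmod_add_nat_le q k : 0 < k ->
  Cmod (q + RtoC k) <= k * exp (Re q / k + Cmod q ^ 2 / (2 * k ^ 2)).
Proof.
  intros hk.
  apply Rsqr_incr_0_var; [|left; apply Rmult_lt_0_compat; auto; apply exp_pos].
  rewrite !Rsqr_pow2, Rpow_mult_distr, Cmod2_alt, Cmod2_alt.
  set (r := Re q). set (i := Im q).
  replace (exp (r / k + (r ^ 2 + i ^ 2) / (2 * k ^ 2)) ^ 2)
    with (exp (2 * (r / k) + (r ^ 2 + i ^ 2) / k ^ 2)).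
  2:{ rewrite <- (Rsqr_pow2 (exp _)); unfold Rsqr; rewrite <- exp_plus. f_equal. field. lra. }
  assert (h := exp_ineq1_le (2 * (r / k) + (r ^ 2 + i ^ 2) / k ^ 2)).
  replace (Re (q + RtoC k)) with (r + k) by (unfold r; destruct q; reflexivity).
  replace (Im (q + RtoC k)) with i by (unfold i; destruct q; simpl; ring).
  apply Rle_trans with (k ^ 2 * (1 + (2 * (r / k) + (r ^ 2 + i ^ 2) / k ^ 2))).
  - right. field. lra.
  - apply Rmult_le_compat_l; [|lra]. apply pow2_ge_0.
Qed.

(** The product of the bounds of [Cmod_add_nat_le].  The exponent is shaped for the
    induction: the sum of Re q / k is compared with Re q ln, the sum of |q|^2 / (2 k^2) with a
    telescoping one, and the same term 2 - 1 / (m + 1) also absorbs the difference between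
    1 / k and ln (k + 1) - ln k.  What matters is only the growth m! m^Re q. *)
Lemma rising_bound q m : 0 <= Re q ->
  Cmod (rising q (S m)) <= Cmod q * INR (fact m) *
    exp (Re q * ln (INR (S m)) + (Re q + Cmod q ^ 2) * (2 - / INR (S m))).
Proof.
  intros hq. induction m as [|m IH].
  - replace (rising q 1) with q by (simpl; ring).
    replace (INR (fact 0)) with 1 by reflexivity. replace (INR 1) with 1 by reflexivity.
    rewrite ln_1, Rinv_1, Rmult_1_r, <- (Rmult_1_r (Cmod q)) at 1.
    apply Rmult_le_compat_l; [apply Cmod_ge_0|].
    apply Rle_trans with (exp 0); [rewrite exp_0; lra|apply exp_le]. generalize (pow2_ge_0 (Cmod q)); lra.
  - change (rising q (S (S m))) with (rising q (S m) * (q + RtoC (INR (S m))))%C.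
    rewrite Cmod_mult.
    set (k := INR (S m)) in *.
    assert (hk : 1 <= k) by (unfold k; rewrite S_INR; generalize (pos_INR m); lra).
    assert (Ek : INR (S (S m)) = k + 1) by (unfold k; rewrite (S_INR (S m)); reflexivity).
    rewrite Ek, fact_simpl, mult_INR. fold k.
    assert (h := Cmod_add_nat_le q k ltac:(lra)).
    eapply Rle_trans.
    { apply Rmult_le_compat; try apply Cmod_ge_0; [exact IH|exact h]. }
    set (s := Cmod q ^ 2). assert (hs : 0 <= s) by apply pow2_ge_0.
    transitivity (Cmod q * (k * INR (fact m)) *
       (exp (Re q * ln k + (Re q + s) * (2 - / k)) * exp (Re q / k + s / (2 * k ^ 2)))).
    { right; ring. }
    apply Rmult_le_compat_l.
    { repeat apply Rmult_le_pos; try apply Cmod_ge_0; try apply pos_INR; lra. }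
    rewrite <- exp_plus. apply exp_le.
    assert (hl : / (k + 1) <= ln (k + 1) - ln k).
    { assert (h1 := ln_le_sub_1 (k / (k + 1)) ltac:(apply Rdiv_lt_0_compat; lra)).
      rewrite ln_div in h1 by lra.
      replace (k / (k + 1) - 1) with (- / (k + 1)) in h1 by (field; lra). lra. }
    assert (hl2 : Re q * / (k + 1) <= Re q * (ln (k + 1) - ln k))
      by (apply Rmult_le_compat_l; lra).
    assert (h3 : s / (2 * k ^ 2) <= s * (/ k - / (k + 1))).
    { unfold Rdiv. apply Rmult_le_compat_l; auto.
      replace (/ k - / (k + 1)) with (/ (k * (k + 1))) by (field; lra).
      apply Rinv_le_contravar; [apply Rmult_lt_0_compat; lra|].
      simpl. rewrite Rmult_1_r. rewrite (Rmult_comm 2), Rmult_assoc.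
      apply Rmult_le_compat_l; lra. }
    assert (E : Re q * ln (k + 1) + (Re q + s) * (2 - / (k + 1)) -
      (Re q * ln k + (Re q + s) * (2 - / k) + (Re q / k + s / (2 * k ^ 2)))
      = (Re q * (ln (k + 1) - ln k) - Re q * / (k + 1)) + (s * (/ k - / (k + 1)) - s / (2 * k ^ 2))).
    { field. lra. }
    lra.
Qed.

(** If Gamma(q) = 0 then |B(N, q)| <= K N^(-Re q - 1), whereas [beta_int_nat] and
    [rising_bound] with N = m + 1 give |B(N, q)| >= N^(-Re q) / A for a constant A; this bounds
    N by A K. *)
Lemma Euler_Gamma_neq_0 q : 0 < Re q -> Euler_Gamma q <> 0%C.
Proof.
  intros hq E0.
  destruct (beta_scaled_close 0 q hq) as [K [N0 [hN0 HK]]].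
  set (A := Cmod q * exp (2 * (Re q + Cmod q ^ 2))).
  assert (hA : 0 <= A) by (unfold A; apply Rmult_le_pos; [apply Cmod_ge_0|left; apply exp_pos]).
  assert (C0 : forall m, N0 <= INR (S m) -> INR (S m) <= A * K).
  { intros m hm. specialize (HK _ hm).
    set (k := INR (S m)) in *.
    assert (hk : 1 <= k) by (unfold k; rewrite S_INR; generalize (pos_INR m); lra).
    rewrite E0 in HK. unfold beta_scaled in HK.
    replace (_ - _)%C with (Cexp (q * RtoC (ln k)) * beta_int (RtoC k) q)%C in HK
      by (rewrite Cplus_0_l; ring).
    rewrite Cmod_mult, Cmod_Cexp in HK.
    replace (Re (q * RtoC (ln k))) with (Re q * ln k) in HK by (destruct q; simpl; ring).
    assert (E := f_equal Cmod (beta_int_nat q m hq)).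
    fold k in E. rewrite Cmod_mult, Cmod_R, Rabs_pos_eq in E by apply pos_INR.
    assert (hr := rising_bound q m ltac:(lra)). fold k in hr.
    set (b := Cmod (beta_int k q)) in *.
    assert (hb : 0 <= b) by apply Cmod_ge_0.
    assert (hf : 0 < INR (fact m)) by apply INR_fact_lt_0.
    assert (h1 : exp (Re q * ln k + (Re q + Cmod q ^ 2) * (2 - / k))
       <= exp (Re q * ln k) * exp (2 * (Re q + Cmod q ^ 2))).
    { rewrite <- exp_plus. apply exp_le.
      assert (0 <= (Re q + Cmod q ^ 2) * / k).
      { apply Rmult_le_pos; [generalize (pow2_ge_0 (Cmod q)); lra|].
        left; apply Rinv_0_lt_compat; lra. }
      lra. }
    assert (h2 : INR (fact m) <= INR (fact m) * (A * (exp (Re q * ln k) * b))).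
    { rewrite <- E at 1.
      apply Rle_trans with (Cmod q * INR (fact m) * (exp (Re q * ln k) * exp (2 * (Re q + Cmod q ^ 2))) * b).
      - apply Rmult_le_compat_r; auto. eapply Rle_trans; [exact hr|].
        apply Rmult_le_compat_l; [|exact h1]. apply Rmult_le_pos; [apply Cmod_ge_0|lra].
      - right; unfold A; ring. }
    assert (h3 : 1 <= A * (exp (Re q * ln k) * b)).
    { apply Rmult_le_reg_l with (INR (fact m)); lra. }
    assert (h4 : A * (exp (Re q * ln k) * b) <= A * (K / k)) by (apply Rmult_le_compat_l; auto).
    apply Rmult_le_reg_r with (/ k); [apply Rinv_0_lt_compat; lra|].
    rewrite Rinv_r by lra. unfold Rdiv in h4. lra. }
  destruct (INR_unbounded (Rmax N0 (A * K))) as [n hn].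
  assert (h1 := Rmax_l N0 (A * K)). assert (h2 := Rmax_r N0 (A * K)).
  assert (h3 : INR n <= INR (S n)) by (rewrite S_INR; lra).
  specialize (C0 n ltac:(lra)). lra.
Qed.

Notation limC u l := (filterlim u eventually (locally (T := AbsRing_UniformSpace C_AbsRing) l)).

Lemma beta_scaled_lim p q : 0 < Re q ->
  limC (fun m => beta_scaled p q (INR (S m))) (Euler_Gamma q).
Proof.
  intros hq. destruct (beta_scaled_close p q hq) as [K [N0 [hN0 HK]]].
  intros P [eps HP].
  destruct (INR_unbounded (Rmax N0 (K / eps))) as [n hn].
  exists n. intros m hm. apply HP.
  assert (h1 := Rmax_l N0 (K / eps)). assert (h2 := Rmax_r N0 (K / eps)).
  assert (h3 : INR n <= INR (S m)) by (apply le_INR; lia).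
  change (Cmod (beta_scaled p q (INR (S m)) - Euler_Gamma q) < eps).
  eapply Rle_lt_trans; [apply HK; lra|].
  assert (he := cond_pos eps).
  apply Rmult_lt_reg_r with (INR (S m)); [lra|].
  unfold Rdiv at 1; rewrite Rmult_assoc, Rinv_l, Rmult_1_r by lra.
  assert (K / eps * eps < INR (S m) * eps) by (apply Rmult_lt_compat_r; lra).
  replace (K / eps * eps) with K in H by (field; lra). lra.
Qed.

(** The limit of B(p, q) N^(p+q) B(N, p+q) = N^p B(N, p) N^q B(p+N, q), taken on both sides
    with [beta_scaled_lim]. *)
Theorem beta_int_Gamma p q : 0 < Re p -> 0 < Re q ->
  (beta_int p q * Euler_Gamma (p + q) = Euler_Gamma p * Euler_Gamma q)%C.
Proof.
  intros hp hq.
  assert (hpq : 0 < Re (p + q)) by (rewrite re_plus; lra).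
  assert (L1 : limC (fun m => beta_int p q * beta_scaled 0 (p + q) (INR (S m)))%C
                 (beta_int p q * Euler_Gamma (p + q))%C).
  { apply (filterlim_comp_2 (G := locally (T := AbsRing_UniformSpace C_AbsRing) (beta_int p q))
      (H := locally (T := AbsRing_UniformSpace C_AbsRing) (Euler_Gamma (p + q)))).
    - apply filterlim_const.
    - apply beta_scaled_lim; auto.
    - apply (filterlim_mult (K := C_AbsRing)). }
  assert (L2 : limC (fun m => beta_scaled 0 p (INR (S m)) * beta_scaled p q (INR (S m)))%C
                 (Euler_Gamma p * Euler_Gamma q)%C).
  { apply (filterlim_comp_2 (G := locally (T := AbsRing_UniformSpace C_AbsRing) (Euler_Gamma p))
      (H := locally (T := AbsRing_UniformSpace C_AbsRing) (Euler_Gamma q))).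
    - apply beta_scaled_lim; auto.
    - apply beta_scaled_lim; auto.
    - apply (filterlim_mult (K := C_AbsRing)). }
  refine (filterlim_locally_unique (F := eventually) (V := AbsRing_NormedModule C_AbsRing)
    _ _ _ L1 _).
  refine (filterlim_ext _ _ _ L2). intros m.
  unfold beta_scaled. rewrite !Cplus_0_l.
  replace ((p + q) * RtoC (ln (INR (S m))))%C with
    (p * RtoC (ln (INR (S m))) + q * RtoC (ln (INR (S m))))%C by ring.
  rewrite Cexp_plus.
  set (k := INR (S m)).
  (* The powers of N cancel.  Multiplied by the rising products of p and of p + q, the
     remaining identity has both sides equal to m! times [r2 * beta_int (p + k) q]. *)
  enough (E : (beta_int k p * beta_int (p + k) q = beta_int p q * beta_int k (p + q))%C).
  { transitivity (Cexp (p * RtoC (ln k)) * Cexp (q * RtoC (ln k)) * (beta_int k p * beta_int (p + k) q))%C; [ring|].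
    rewrite E; ring. }
  assert (E1 := beta_int_nat p m hp). assert (E2 := beta_int_nat (p + q) m hpq).
  assert (E3 := beta_int_rising p q (S m) hp hq). fold k in E1, E2, E3.
  assert (hf : RtoC (INR (fact m)) <> 0%C).
  { intros h; apply RtoC_inj in h. generalize (INR_fact_lt_0 m); lra. }
  set (f := RtoC (INR (fact m))) in *.
  set (r1 := rising p (S m)) in *. set (r2 := rising (p + q) (S m)) in *.
  assert (hr1 : r1 <> 0%C) by (intros h; rewrite h, Cmult_0_l in E1; auto).
  assert (hr2 : r2 <> 0%C) by (intros h; rewrite h, Cmult_0_l in E2; auto).
  assert (E4 : (beta_int k p = f / r1)%C) by (rewrite <- E1; field; auto).
  assert (E5 : (beta_int k (p + q) = f / r2)%C) by (rewrite <- E2; field; auto).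
  assert (E6 : (beta_int p q = r2 * beta_int (p + k) q / r1)%C) by (rewrite <- E3; field; auto).
  rewrite E4, E5, E6. field; auto.
Qed.

(** * Complex series and termwise integration *)

Notation is_Cseries a l := (is_series (V := C_R_NormedModule) a l).

Lemma CSeries_unique a l : is_Cseries a l -> CSeries a = l.
Proof. intros h. apply (iota_filterlim_locally (V := C_R_CompleteNormedModule) (sum_n a) l h). Qed.

Lemma is_Cseries_CSeries a : ex_series (V := C_R_NormedModule) a -> is_Cseries a (CSeries a).
Proof. intros [l h]. rewrite (CSeries_unique a l h). exact h. Qed.

Lemma sum_n_C_S (a : nat -> C) n :
  @eq C (sum_n (G := C_R_NormedModule) a (S n))
    (sum_n (G := C_R_NormedModule) a n + a (S n))%C.
Proof. apply (sum_Sn (G := C_R_NormedModule)). Qed.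

Lemma sum_n_C_mult (c : C) (a : nat -> C) n :
  @eq C (sum_n (G := C_R_NormedModule) (fun k => (c * a k)%C) n)
    (c * sum_n (G := C_R_NormedModule) a n)%C.
Proof.
  induction n as [|n IH]; [rewrite !sum_O; reflexivity|].
  rewrite !sum_n_C_S, IH. ring.
Qed.

Lemma is_Cseries_mult (c : C) a l :
  is_Cseries a l -> is_Cseries (fun k => (c * a k)%C) (c * l)%C.
Proof.
  intros h. apply (filterlim_ext (fun n => (c * sum_n (G := C_R_NormedModule) a n)%C)).
  { intros n; symmetry; apply sum_n_C_mult. }
  eapply filterlim_comp; [exact h|apply filterlim_Cmult_l].
Qed.

Lemma ball_of_Cmod (x y : C) (eps : R) :
  Cmod (y - x) < eps -> ball (M := C_R_NormedModule) x eps y.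
Proof. intros h. apply (norm_compat1 (V := C_R_NormedModule)). rewrite <- Cmod_norm. exact h. Qed.

Lemma contC_Cmod (f : R -> C) x (eps : posreal) :
  contC f x -> locally x (fun y => Cmod (f y - f x) < eps).
Proof.
  intros h. apply (h (fun z => Cmod (z - f x) < eps)).
  apply (locally_le_locally_norm (V := C_R_NormedModule)).
  exists eps. intros y hy. unfold ball_norm in hy. rewrite <- Cmod_norm in hy. exact hy.
Qed.

Definition series_tail (b : nat -> R) (N : nat) : R := Series b - sum_n b N.

Lemma series_tail_lim b : ex_series b -> is_lim_seq (series_tail b) 0.
Proof.
  intros h. unfold series_tail. replace (Finite 0) with (Finite (Series b - Series b)) by (f_equal; ring).
  apply is_lim_seq_minus'; [apply is_lim_seq_const|]. apply Series_correct; auto.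
Qed.

Lemma sum_n_le_Series b m : (forall n, 0 <= b n) -> ex_series b -> sum_n b m <= Series b.
Proof.
  intros hb h.
  apply (is_lim_seq_incr_compare (sum_n b)).
  - apply Series_correct; auto.
  - intros n. rewrite sum_Sn. unfold plus; simpl. specialize (hb (S n)). lra.
Qed.

(** The bound holds for the difference of two partial sums, and then, up to any eps, for the
    limit. *)
Lemma Cmod_sub_sum_n_le (a : nat -> C) (b : nat -> R) (l : C) N :
  (forall n, Cmod (a n) <= b n) -> ex_series b -> is_Cseries a l ->
  Cmod (l - sum_n (G := C_R_NormedModule) a N) <= series_tail b N.
Proof.
  intros hab hb ha.
  assert (hb0 : forall n, 0 <= b n) by (intros n; generalize (Cmod_ge_0 (a n)) (hab n); lra).
  assert (step : forall k, Cmod (sum_n (G := C_R_NormedModule) a (k + N) - sum_n (G := C_R_NormedModule) a N)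
       <= sum_n b (k + N) - sum_n b N).
  { induction k as [|k IH].
    - simpl. replace (_ - _)%C with (RtoC 0) by ring. rewrite Cmod_0. lra.
    - simpl. rewrite sum_n_C_S, sum_Sn. unfold plus at 1; simpl.
      replace (_ - _)%C with ((sum_n (G := C_R_NormedModule) a (k + N) - sum_n (G := C_R_NormedModule) a N)
        + a (S (k + N)))%C by ring.
      eapply Rle_trans; [apply Cmod_triangle|]. specialize (hab (S (k + N))). lra. }
  apply le_epsilon. intros eps heps.
  assert (hl : eventually (fun n => Cmod (sum_n (G := C_R_NormedModule) a n - l) < eps)).
  { apply (ha (fun z => Cmod (z - l) < eps)). apply (locally_le_locally_norm (V := C_R_NormedModule)).
    exists (mkposreal eps heps). intros y hy. unfold ball_norm in hy. rewrite <- Cmod_norm in hy. exact hy. }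
  destruct hl as [m hm]. specialize (hm (m + N)%nat ltac:(lia)). specialize (step m).
  assert (hS := sum_n_le_Series b (m + N) hb0 hb).
  replace (l - sum_n (G := C_R_NormedModule) a N)%C with
    (- (sum_n (G := C_R_NormedModule) a (m + N) - l) +
     (sum_n (G := C_R_NormedModule) a (m + N) - sum_n (G := C_R_NormedModule) a N))%C by ring.
  eapply Rle_trans; [apply Cmod_triangle|]. rewrite Cmod_opp. unfold series_tail. lra.
Qed.

Lemma ex_Cseries_dominated (a : nat -> C) (b : nat -> R) :
  (forall n, Cmod (a n) <= b n) -> ex_series b -> ex_series (V := C_R_NormedModule) a.
Proof.
  intros hab hb. apply (ex_series_le (V := C_R_CompleteNormedModule) a b); auto.
  intros n. specialize (hab n). rewrite Cmod_norm in hab. exact hab.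
Qed.

Lemma contC_sum_n (f : nat -> R -> C) N x :
  (forall n, contC (f n) x) -> contC (fun t => sum_n (G := C_R_NormedModule) (fun n => f n t) N) x.
Proof.
  intros h. induction N as [|N IH].
  - apply (continuous_ext (f O)); [|auto]. intros t; rewrite sum_O; reflexivity.
  - apply (continuous_ext (fun t => (sum_n (G := C_R_NormedModule) (fun n => f n t) N + f (S N) t)%C)).
    { intros t; rewrite sum_n_C_S; reflexivity. }
    apply contC_plus; auto.
Qed.

Lemma is_int_sum_n (f : nat -> R -> C) (I : nat -> C) N :
  (forall n, is_int (f n) (I n)) ->
  is_int (fun x => sum_n (G := C_R_NormedModule) (fun n => f n x) N) (sum_n (G := C_R_NormedModule) I N).
Proof.
  intros h. induction N as [|N IH].
  - rewrite sum_O. apply (is_int_ext (f O)); [|auto]. intros; rewrite sum_O; reflexivity.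
  - rewrite sum_n_C_S.
    apply (is_int_ext (fun t => (sum_n (G := C_R_NormedModule) (fun n => f n t) N + f (S N) t)%C)).
    { intros; rewrite sum_n_C_S; reflexivity. }
    apply is_int_plus; auto.
Qed.

(** A dominated series converges uniformly, so its sum is continuous. *)
Lemma contC_series (f : nat -> R -> C) (S : R -> C) (b : nat -> R) x :
  0 < x -> ex_series b ->
  (forall n t, 0 < t -> Cmod (f n t) <= b n) ->
  (forall n, contC (f n) x) ->
  (forall t, 0 < t -> is_Cseries (fun n => f n t) (S t)) ->
  contC S x.
Proof.
  intros hx hb hfb hf hS.
  intros P [eps HP].
  set (e := pos_div_2 (pos_div_2 eps)).
  assert (ht := series_tail_lim b hb). apply is_lim_seq_spec in ht.
  destruct (ht e) as [N hN]. specialize (hN N (le_n N)).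
  rewrite Rminus_0_r in hN. apply Rabs_def2 in hN.
  assert (hc := contC_Cmod _ x e (contC_sum_n f N x hf)).
  assert (hp : locally x (fun t => 0 < t)) by (apply (open_gt 0); exact hx).
  unfold filtermap. generalize (filter_and _ _ hp hc). apply filter_imp. intros t [htp htc]. apply HP.
  apply ball_of_Cmod.
  assert (B1 := Cmod_sub_sum_n_le _ b _ N (fun n => hfb n t htp) hb (hS t htp)).
  assert (B2 := Cmod_sub_sum_n_le _ b _ N (fun n => hfb n x hx) hb (hS x hx)).
  simpl in htc, hN.
  set (s := sum_n (G := C_R_NormedModule) (fun n => f n t) N) in *.
  set (s0 := sum_n (G := C_R_NormedModule) (fun n => f n x) N) in *.
  replace (S t - S x)%C with ((S t - s) + (s - s0) + - (S x - s0))%C by ring.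
  eapply Rle_lt_trans; [apply Cmod_triangle|]. rewrite Cmod_opp.
  assert (B3 := Cmod_triangle (S t - s) (s - s0)).
  generalize (cond_pos eps); lra.
Qed.

(** Termwise integration of E (f 0 + f 1 + ...) when E has a power-exponential bound and the
    series is dominated by constants: the remainder after N terms is at most E times the tail
    of [b], so its integral is at most a fixed multiple of that tail. *)
Lemma is_int_series (E : R -> C) (f : nat -> R -> C) (S : R -> C) (b : nat -> R)
    (I : nat -> C) (al be K : R) :
  0 < al -> 0 < be -> 0 <= K ->
  (forall x, 0 < x -> contC E x) ->
  (forall x, 0 < x -> Cmod (E x) <= K * exp ((al - 1) * ln x - be * x)) ->
  ex_series b ->
  (forall n x, 0 < x -> Cmod (f n x) <= b n) ->
  (forall n x, 0 < x -> contC (f n) x) ->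
  (forall x, 0 < x -> is_Cseries (fun n => f n x) (S x)) ->
  (forall n, is_int (fun x => (E x * f n x)%C) (I n)) ->
  exists J, is_int (fun x => (E x * S x)%C) J /\ is_Cseries I J.
Proof.
  intros hal hbe hK cE bE hb hfb cf hS hI.
  destruct (is_int_power_exp_bound al hal) as [M [hM HM]].
  assert (hb0 : forall n, 0 <= b n).
  { intros n. generalize (hfb n 1 Rlt_0_1) (Cmod_ge_0 (f n 1)). lra. }
  assert (cS : forall x, 0 < x -> contC S x) by (intros x hx; apply (contC_series f S b); auto).
  assert (T0 : forall N, 0 <= series_tail b N).
  { intros N. unfold series_tail. generalize (sum_n_le_Series b N hb0 hb). lra. }
  assert (D : forall N, exists J, is_int (fun x => (E x * (S x - sum_n (G := C_R_NormedModule) (fun n => f n x) N))%C) J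
     /\ Cmod J <= (K * series_tail b N) * M * exp (- al * ln be)).
  { intros N. apply HM; auto.
    - apply Rmult_le_pos; auto.
    - intros x hx. apply contC_mult; auto. apply contC_minus; auto. apply contC_sum_n; auto.
    - intros x hx. rewrite Cmod_mult.
      replace (K * series_tail b N * exp ((al - 1) * ln x - be * x))
        with (K * exp ((al - 1) * ln x - be * x) * series_tail b N) by ring.
      apply Rmult_le_compat; try apply Cmod_ge_0; auto.
      apply (Cmod_sub_sum_n_le _ b _ N); auto. }
  assert (I1 : forall N, is_int (fun x => (E x * sum_n (G := C_R_NormedModule) (fun n => f n x) N)%C)
      (sum_n (G := C_R_NormedModule) I N)).
  { intros N. apply (is_int_ext (fun x => sum_n (G := C_R_NormedModule) (fun n => (E x * f n x)%C) N)).
    { intros; apply sum_n_C_mult. }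
    apply (is_int_sum_n (fun n x => (E x * f n x)%C)); auto. }
  destruct (D O) as [D0 [HD0 _]].
  assert (HJ : is_int (fun x => (E x * S x)%C) (D0 + sum_n (G := C_R_NormedModule) I 0)%C).
  { apply (is_int_ext (fun x => (E x * (S x - sum_n (G := C_R_NormedModule) (fun n => f n x) 0)
         + E x * sum_n (G := C_R_NormedModule) (fun n => f n x) 0)%C)).
    { intros; ring. }
    apply is_int_plus; auto. }
  set (J := (D0 + sum_n (G := C_R_NormedModule) I 0)%C) in *.
  exists J. split; [exact HJ|].
  set (c := K * M * exp (- al * ln be)).
  assert (hl : is_lim_seq (fun N => c * series_tail b N) 0).
  { replace (Finite 0) with (Rbar_mult c 0) by (simpl; f_equal; ring).
    apply is_lim_seq_scal_l. apply series_tail_lim; auto. }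
  apply is_lim_seq_spec in hl.
  intros P [eps HP]. destruct (hl eps) as [N0 hN0]. exists N0. intros N hN.
  apply HP, ball_of_Cmod. specialize (hN0 N hN). rewrite Rminus_0_r in hN0.
  apply Rabs_def2 in hN0.
  destruct (D N) as [DN [HDN BDN]].
  assert (E1 : DN = (J - sum_n (G := C_R_NormedModule) I N)%C).
  { eapply is_int_unique; [exact HDN|].
    apply (is_int_ext (fun x => (E x * S x - E x * sum_n (G := C_R_NormedModule) (fun n => f n x) N)%C)).
    { intros; ring. }
    apply is_int_minus; auto. }
  replace (sum_n (G := C_R_NormedModule) I N - J)%C with (- DN)%C by (rewrite E1; ring).
  rewrite Cmod_opp. unfold c in hN0. lra.
Qed.

(** * The Bessel series against a Beta kernel *)

Lemma Gamma_shift_pos z : 0 < Re z -> Gamma_shift z = O.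
Proof.
  intros h. unfold Gamma_shift.
  destruct (archimed (- Re z)) as [_ h2].
  assert (hz : (up (- Re z) < 1)%Z) by (apply lt_IZR; lra).
  destruct (up (- Re z)); simpl; lia.
Qed.

Lemma Gamma_pos z : 0 < Re z -> Gamma z = Euler_Gamma z.
Proof.
  intros h. unfold Gamma. rewrite Gamma_shift_pos by auto. simpl.
  rewrite Cplus_0_r. field.
Qed.

Lemma rGamma_pos z : 0 < Re z -> rGamma z = (/ Euler_Gamma z)%C.
Proof.
  intros h. unfold rGamma. rewrite Gamma_shift_pos by auto. simpl.
  rewrite Cplus_0_r. unfold Cdiv. ring.
Qed.

(** By the functional equation each step multiplies 1 / Gamma by 1 / (v + 1 + n), of modulus
    at most 1 / (Re v + 1).  A geometric bound is enough, since the factorial in the Bessel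
    series makes it converge. *)
Lemma rGamma_shift_bound v : - 1 < Re v ->
  exists K, 0 <= K /\ forall n,
    Cmod (rGamma (RtoC (1 * INR n) + v + 1)) <= K * (/ (Re v + 1)) ^ n.
Proof.
  intros hv. set (d := Re v + 1).
  assert (hd : 0 < d) by (unfold d; lra).
  exists (Cmod (/ Euler_Gamma (v + 1))). split; [apply Cmod_ge_0|].
  intros n.
  assert (hpos : forall n, 0 < Re (v + 1 + RtoC (INR n))).
  { intros k. rewrite !re_plus, !re_RtoC. generalize (pos_INR k). fold d. lra. }
  replace (RtoC (1 * INR n) + v + 1)%C with (v + 1 + RtoC (INR n))%C
    by (rewrite Rmult_1_l; ring).
  induction n as [|n IH].
  - rewrite rGamma_pos by auto. simpl. rewrite Cplus_0_r. lra.
  - rewrite rGamma_pos in * by auto.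
    assert (hn := hpos n).
    replace (v + 1 + RtoC (INR (S n)))%C with (v + 1 + RtoC (INR n) + 1)%C
      by (rewrite S_INR, RtoC_plus; ring).
    rewrite Euler_Gamma_succ by auto.
    set (w := (v + 1 + RtoC (INR n))%C) in *.
    assert (hw : d <= Cmod w).
    { eapply Rle_trans; [|apply re_le_Cmod]. eapply Rle_trans; [|apply Rle_abs].
      unfold w. rewrite !re_plus, !re_RtoC. generalize (pos_INR n). fold d. lra. }
    assert (hw0 : w <> 0%C) by (apply Cmod_gt_0; lra).
    assert (hG := Euler_Gamma_neq_0 w hn).
    replace (/ (w * Euler_Gamma w))%C with (/ Euler_Gamma w * / w)%C by (field; auto).
    rewrite Cmod_mult, (Cmod_inv w) by auto. simpl.
    rewrite (Rmult_comm (/ d)), <- Rmult_assoc.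
    apply Rmult_le_compat; try apply Cmod_ge_0; auto.
    + left; apply Rinv_0_lt_compat; lra.
    + apply Rinv_le_contravar; auto.
Qed.

(** The coefficients of J_v (s y / 2) as a power series in s.  With s = (1 - exp (-t))^2 this
    isolates the dependence on t and leaves the power of -y / 2 that the Wright series has. *)
Definition Bessel_coef (v y : C) (n : nat) : C :=
  ((- y / 2) ^ n / RtoC (INR (fact n)) * rGamma (RtoC (1 * INR n) + v + 1))%C.

Lemma RtoC_fact_neq_0 n : RtoC (INR (fact n)) <> 0%C.
Proof. intros h; apply RtoC_inj in h. generalize (INR_fact_lt_0 n); lra. Qed.

Lemma Cpow_mult_l (a b : C) n : ((a * b) ^ n = a ^ n * b ^ n)%C.
Proof. induction n as [|n IH]; simpl; [ring|]. rewrite IH; ring. Qed.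

Lemma Bessel_Maitland_term_half v y s n :
  Bessel_Maitland_term 1 v (RtoC (s / 2) * y) n = (Bessel_coef v y n * RtoC s ^ n)%C.
Proof.
  unfold Bessel_Maitland_term, Bessel_coef.
  replace (- (RtoC (s / 2) * y))%C with ((- y / 2) * RtoC s)%C
    by (rewrite RtoC_div by lra; field; intros h; apply RtoC_inj in h; lra).
  rewrite Cpow_mult_l. field. apply RtoC_fact_neq_0.
Qed.

Lemma Bessel_coef_bound v y : - 1 < Re v ->
  exists b, ex_series b /\ forall n, Cmod (Bessel_coef v y n) <= b n.
Proof.
  intros hv. destruct (rGamma_shift_bound v hv) as [K [hK bK]].
  set (r := Cmod (- y / 2) * / (Re v + 1)).
  exists (fun n => K * (/ INR (fact n) * r ^ n)). split.
  - apply (ex_series_scal_l K (fun n => / INR (fact n) * r ^ n)).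
    exists (exp r). apply (is_series_ext (fun n => scal (pow_n r n) (/ INR (fact n)))).
    { intros n. rewrite pow_n_pow. unfold scal; simpl; unfold mult; simpl. ring. }
    apply is_exp_Reals.
  - intros n. unfold Bessel_coef.
    assert (hf := INR_fact_lt_0 n).
    rewrite Cmod_mult, Cmod_div, Cmod_pow, Cmod_R, Rabs_pos_eq by (try apply RtoC_fact_neq_0; lra).
    eapply Rle_trans.
    { apply Rmult_le_compat_l; [|apply bK].
      apply Rmult_le_pos; [apply pow_le, Cmod_ge_0|left; apply Rinv_0_lt_compat; auto]. }
    right. unfold r. rewrite Rpow_mult_distr. field. lra.
Qed.

Lemma Cmod_mult_pow_le (c : C) (s b : R) n :
  0 <= s <= 1 -> Cmod c <= b -> Cmod (c * RtoC s ^ n) <= b.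
Proof.
  intros hs hb. rewrite Cmod_mult, Cmod_pow, Cmod_R, Rabs_pos_eq by lra.
  rewrite <- (Rmult_1_r b).
  apply Rmult_le_compat; auto; try apply Cmod_ge_0; [apply pow_le; lra|].
  rewrite <- (pow1 n). apply pow_incr; lra.
Qed.

Lemma is_Cseries_BesselJ v y s : - 1 < Re v -> 0 <= s <= 1 ->
  is_Cseries (fun n => (Bessel_coef v y n * RtoC s ^ n)%C) (BesselJ v (RtoC (s / 2) * y)).
Proof.
  intros hv hs. destruct (Bessel_coef_bound v y hv) as [b [hb bb]].
  apply (is_series_ext (V := C_R_NormedModule) (Bessel_Maitland_term 1 v (RtoC (s / 2) * y))).
  { intros n; apply Bessel_Maitland_term_half. }
  apply is_Cseries_CSeries. apply ex_Cseries_dominated with b; auto.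
  intros n. rewrite Bessel_Maitland_term_half. apply Cmod_mult_pow_le; auto.
Qed.

Definition sq_1_exp (x : R) : R := (1 - exp (- x)) ^ 2.

Lemma sq_1_exp_bounds x : 0 < x -> 0 <= sq_1_exp x <= 1.
Proof.
  intros hx. assert (h := one_minus_exp_pos x hx). unfold sq_1_exp.
  assert (h2 := exp_pos (- x)). split; [apply pow_le; lra|].
  rewrite <- (pow1 2). apply pow_incr; lra.
Qed.

(** Powers of (1 - exp (-x))^2 are absorbed in the second parameter, so every term of the
    Bessel series is again a Beta integral. *)
Lemma beta_kernel_mul_sq_1_exp p q n x : 0 < x ->
  (beta_kernel p q x * RtoC (sq_1_exp x) ^ n)%C = beta_kernel p (q + RtoC (2 * INR n)) x.
Proof.
  intros hx. assert (h := one_minus_exp_pos x hx).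
  induction n as [|n IH].
  - simpl. rewrite Rmult_0_r, Cplus_0_r. ring.
  - simpl Cpow. rewrite S_INR.
    transitivity ((beta_kernel p q x * RtoC (sq_1_exp x) ^ n) * RtoC (sq_1_exp x))%C; [ring|].
    rewrite IH. unfold beta_kernel, sq_1_exp.
    replace ((1 - exp (- x)) ^ 2) with (exp (2 * ln_1_exp x)).
    2:{ unfold ln_1_exp. rewrite <- (exp_ln (1 - exp (- x)) h) at 2.
        simpl. rewrite Rmult_1_r, <- exp_plus. f_equal; ring. }
    rewrite <- Cexp_RtoC, <- Cexp_plus. f_equal.
    rewrite Rmult_plus_distr_l, RtoC_plus, !RtoC_mult. ring.
Qed.

(** The second summand comes from the factor 1 + exp (-x) contributed by dx in the
    substitution. *)
Definition beta_sum_kernel (p q : C) (x : R) : C :=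
  (beta_kernel p q x + beta_kernel (p + 1) q x)%C.

(** By [beta_int_succ] the sum is B(p, q) (1 + p / (p + q)). *)
Lemma beta_sum_value p q : 0 < Re p -> 0 < Re q ->
  (beta_int p q + beta_int (p + 1) q)%C =
  ((2 * p + q) * (Euler_Gamma p * Euler_Gamma q / Euler_Gamma (p + q + 1)))%C.
Proof.
  intros hp hq.
  assert (hpq : 0 < Re (p + q)) by (rewrite re_plus; lra).
  assert (E1 := beta_int_succ p q hp hq). assert (E2 := beta_int_Gamma p q hp hq).
  rewrite (Euler_Gamma_succ (p + q) hpq).
  assert (hG := Euler_Gamma_neq_0 _ hpq).
  assert (h0 : (p + q)%C <> 0%C) by (intros h; rewrite h, re_RtoC in hpq; lra).
  assert (E3 : (beta_int (p + 1) q = p * beta_int p q / (p + q))%C) by (rewrite E1; field; auto).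
  rewrite <- E2, E3. field; auto.
Qed.

Lemma is_int_beta_sum p q n : 0 < Re p -> 0 < Re q ->
  is_int (fun x => (beta_sum_kernel p q x * RtoC (sq_1_exp x) ^ n)%C)
    (beta_int p (q + RtoC (2 * INR n)) + beta_int (p + 1) (q + RtoC (2 * INR n)))%C.
Proof.
  intros hp hq.
  assert (hq' : 0 < Re (q + RtoC (2 * INR n))).
  { rewrite re_plus, re_RtoC. generalize (pos_INR n). lra. }
  assert (hp1 : 0 < Re (p + 1)) by (rewrite re_plus, re_RtoC; lra).
  apply (is_int_ext (fun x => (beta_kernel p (q + RtoC (2 * INR n)) x
     + beta_kernel (p + 1) (q + RtoC (2 * INR n)) x)%C)).
  { intros x hx. rewrite <- !beta_kernel_mul_sq_1_exp by auto. unfold beta_sum_kernel. ring. }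
  apply is_int_plus; apply is_int_beta; auto.
Qed.

Lemma beta_sum_kernel_bound p q : 0 < Re p ->
  exists K, 0 <= K /\ forall x, 0 < x ->
   Cmod (beta_sum_kernel p q x) <= K * exp ((Re q - 1) * ln x - Re p / 2 * x).
Proof.
  intros hp. assert (hp1 : 0 < Re (p + 1)) by (rewrite re_plus, re_RtoC; lra).
  destruct (beta_kernel_bound p q hp) as [K1 [hK1 B1]].
  destruct (beta_kernel_bound (p + 1) q hp1) as [K2 [hK2 B2]].
  exists (K1 + K2). split; [lra|]. intros x hx.
  eapply Rle_trans; [apply Cmod_triangle|].
  specialize (B1 x hx). specialize (B2 x hx). rewrite re_plus, re_RtoC in B2.
  assert (h : exp ((Re q - 1) * ln x - (Re p + 1) / 2 * x) <= exp ((Re q - 1) * ln x - Re p / 2 * x)).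
  { apply exp_le. lra. }
  assert (K2 * exp ((Re q - 1) * ln x - (Re p + 1) / 2 * x) <= K2 * exp ((Re q - 1) * ln x - Re p / 2 * x))
    by (apply Rmult_le_compat_l; auto).
  lra.
Qed.

Lemma contC_beta_sum_kernel p q x : 0 < x -> contC (beta_sum_kernel p q) x.
Proof. intros. apply contC_plus; apply contC_beta_kernel; auto. Qed.

Lemma continuous_sq_1_exp x : continuous sq_1_exp x.
Proof. apply (ex_derive_continuous (V := R_NormedModule)). unfold sq_1_exp. auto_derive. auto. Qed.

Lemma contC_BesselJ_sq_1_exp v y x : - 1 < Re v -> 0 < x ->
  contC (fun t => BesselJ v (RtoC (sq_1_exp t / 2) * y)) x.
Proof.
  intros hv hx. destruct (Bessel_coef_bound v y hv) as [b [hb bb]].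
  apply (contC_series (fun n t => Bessel_coef v y n * RtoC (sq_1_exp t) ^ n)%C _ b); auto.
  - intros n t ht. apply Cmod_mult_pow_le; auto. apply sq_1_exp_bounds; auto.
  - intros n. apply contC_mult; [apply contC_const|].
    apply contC_pow, contC_RtoC, continuous_sq_1_exp.
  - intros t ht. apply is_Cseries_BesselJ; auto. apply sq_1_exp_bounds; auto.
Qed.

Lemma is_int_beta_sum_BesselJ p q v y : 0 < Re p -> 0 < Re q -> - 1 < Re v ->
  exists J, is_int (fun x => (beta_sum_kernel p q x * BesselJ v (RtoC (sq_1_exp x / 2) * y))%C) J /\
   is_Cseries (fun n => (Bessel_coef v y n *
     ((2 * p + q + RtoC (2 * INR n)) * (Euler_Gamma p * Euler_Gamma (q + RtoC (2 * INR n))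
        / Euler_Gamma (p + q + RtoC (2 * INR n) + 1))))%C) J.
Proof.
  intros hp hq hv.
  destruct (beta_sum_kernel_bound p q hp) as [K [hK bK]].
  destruct (Bessel_coef_bound v y hv) as [b [hb bb]].
  destruct (is_int_series (beta_sum_kernel p q)
     (fun n x => Bessel_coef v y n * RtoC (sq_1_exp x) ^ n)%C
     (fun x => BesselJ v (RtoC (sq_1_exp x / 2) * y)) b
     (fun n => Bessel_coef v y n * (beta_int p (q + RtoC (2 * INR n)) + beta_int (p + 1) (q + RtoC (2 * INR n))))%C
     (Re q) (Re p / 2) K) as [J [HJ1 HJ2]]; auto.
  - lra.
  - intros; apply contC_beta_sum_kernel; auto.
  - intros n x hx. apply Cmod_mult_pow_le; auto. apply sq_1_exp_bounds; auto.
  - intros n x hx. apply contC_mult; [apply contC_const|].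
    apply contC_pow. apply contC_RtoC. apply continuous_sq_1_exp.
  - intros x hx. apply is_Cseries_BesselJ; auto. apply sq_1_exp_bounds; auto.
  - intros n. apply (is_int_ext (fun x => (Bessel_coef v y n * (beta_sum_kernel p q x * RtoC (sq_1_exp x) ^ n))%C)).
    { intros; ring. }
    apply is_int_Cmult. apply is_int_beta_sum; auto.
  - exists J. split; [exact HJ1|].
    apply (is_series_ext (V := C_R_NormedModule)) with (2 := HJ2). intros n.
    assert (hn : 0 < Re (q + RtoC (2 * INR n))).
    { rewrite re_plus, re_RtoC. generalize (pos_INR n). lra. }
    rewrite (beta_sum_value p (q + RtoC (2 * INR n)) hp hn), !Cplus_assoc.
    reflexivity.
Qed.

(** * The substitution *)

(** The inverse of t |-> a (cosh t - 1) on the half-line. *)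
Definition theta (a x : R) : R := ln ((x + a + sqrt (x ^ 2 + 2 * a * x)) / a).

Lemma sqrt_quad_pos a x : 0 < a -> 0 < x ->
  0 < x ^ 2 + 2 * a * x /\ 0 < sqrt (x ^ 2 + 2 * a * x) /\
  sqrt (x ^ 2 + 2 * a * x) ^ 2 = x ^ 2 + 2 * a * x.
Proof.
  intros ha hx. assert (0 < x ^ 2 + 2 * a * x).
  { apply Rplus_lt_0_compat; [apply pow_lt; auto|repeat apply Rmult_lt_0_compat; lra]. }
  split; [auto|]. split; [apply sqrt_lt_R0; auto|]. apply pow2_sqrt; lra.
Qed.

Lemma theta_pos a x : 0 < a -> 0 < x -> 0 < theta a x.
Proof.
  intros ha hx. destruct (sqrt_quad_pos a x ha hx) as [_ [hs _]].
  unfold theta. rewrite <- ln_1. apply ln_increasing; [lra|].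
  apply Rmult_lt_reg_r with a; auto. unfold Rdiv. rewrite Rmult_assoc, Rinv_l; lra.
Qed.

Lemma is_derive_theta a x : 0 < a -> 0 < x ->
  is_derive (theta a) x (/ sqrt (x ^ 2 + 2 * a * x)).
Proof.
  intros ha hx. destruct (sqrt_quad_pos a x ha hx) as [hq [hs _]].
  unfold theta. auto_derive.
  - split; [exact hq|]. split; [|lra].
    apply Rmult_lt_0_compat; [simpl in hs; lra|apply Rinv_0_lt_compat; auto].
  - simpl in *. field. repeat split; lra.
Qed.

Lemma continuous_inv_sqrt_quad a x : 0 < a -> 0 < x ->
  continuous (fun x => / sqrt (x ^ 2 + 2 * a * x)) x.
Proof.
  intros ha hx. destruct (sqrt_quad_pos a x ha hx) as [hq [hs _]].
  apply (ex_derive_continuous (V := R_NormedModule)). auto_derive.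
  split; [exact hq|]. split; [simpl in hs; lra|auto].
Qed.

Lemma theta_at_0 a : 0 < a -> filterlim (theta a) (at_right 0) (at_right 0).
Proof.
  intros ha.
  assert (hc : continuous (theta a) 0).
  { unfold theta.
    apply (continuous_comp (fun x => (x + a + sqrt (x ^ 2 + 2 * a * x)) / a) ln).
    - apply (continuous_mult (K := R_AbsRing)); [|apply continuous_const].
      apply (continuous_plus (V := R_NormedModule)).
      + apply (ex_derive_continuous (V := R_NormedModule)). auto_derive; auto.
      + apply continuous_sqrt_comp.
        apply (ex_derive_continuous (V := R_NormedModule)). auto_derive; auto.
    - apply continuous_ln.
      replace (0 ^ 2 + 2 * a * 0) with 0 by ring. rewrite sqrt_0.
      replace ((0 + a + 0) / a) with 1 by (field; lra). lra. }
  assert (h0 : theta a 0 = 0).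
  { unfold theta. replace (0 ^ 2 + 2 * a * 0) with 0 by ring. rewrite sqrt_0.
    replace ((0 + a + 0) / a) with 1 by (field; lra). apply ln_1. }
  intros P HP. unfold at_right, within in HP.
  assert (h1 : locally 0 (fun x => 0 < theta a x -> P (theta a x))).
  { unfold continuous in hc. rewrite h0 in hc.
    apply (hc (fun t => 0 < t -> P t)). exact HP. }
  unfold filtermap, at_right, within. revert h1. apply filter_imp.
  intros x h hx. apply h. apply theta_pos; auto.
Qed.

Lemma theta_at_infty a : 0 < a ->
  filterlim (theta a) (Rbar_locally p_infty) (Rbar_locally p_infty).
Proof.
  intros ha. apply filterlim_ge_p_infty with (f := fun x => 1 * (- ln a + ln x)).
  - generalize p_infty_pos; apply filter_imp; intros x hx.
    destruct (sqrt_quad_pos a x ha hx) as [_ [hs _]].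
    unfold theta. rewrite ln_div by lra.
    assert (ln x <= ln (x + a + sqrt (x ^ 2 + 2 * a * x))) by (apply ln_le; lra). lra.
  - eapply (filterlim_comp _ _ _ ln (fun y => 1 * (- ln a + y))); [apply lim_ln_p|].
    apply filterlim_affine_p; lra.
Qed.

(** With w = a exp t one has x = (w - a)^2 / (2 w) and sqrt (x^2 + 2 a x) =
    (w^2 - a^2) / (2 w).  Hence x, w, 1 - exp (-t) and (1 + exp (-t)) dt / dx are products of
    powers of 2, a, w and w - a, and the identity reduces to one between linear combinations
    of logarithms. *)
Lemma integrand_subst a v y lambda mu x : 0 < a -> 0 < x ->
  let w := x + a + sqrt (x ^ 2 + 2 * a * x) in
  (Rcpow x (mu - 1) * Rcpow w (- lambda) * BesselJ v (RtoC x * y / RtoC w))%C =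
  (Rcpow 2 (- mu) * Rcpow a (mu - lambda) *
    (RtoC (/ sqrt (x ^ 2 + 2 * a * x))
     * (beta_sum_kernel (lambda - mu) (2 * mu) (theta a x)
        * BesselJ v (RtoC (sq_1_exp (theta a x) / 2) * y))))%C.
Proof.
  intros ha hx w.
  destruct (sqrt_quad_pos a x ha hx) as [_ [hs hs2]].
  set (s := sqrt (x ^ 2 + 2 * a * x)) in *.
  assert (hw : 0 < w) by (unfold w; lra).
  assert (haw : a < w) by (unfold w; lra).
  assert (hu : exp (- theta a x) = a / w).
  { unfold theta. fold s. fold w. rewrite <- ln_Rinv by (apply Rdiv_lt_0_compat; auto).
    rewrite exp_ln by (apply Rinv_0_lt_compat, Rdiv_lt_0_compat; auto). field. lra. }
  assert (Ex : x = (w - a) ^ 2 / (2 * w)).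
  { apply Rmult_eq_reg_r with (2 * w); [|lra].
    replace ((w - a) ^ 2 / (2 * w) * (2 * w)) with ((w - a) ^ 2) by (field; lra).
    unfold w. replace ((x + a + s - a) ^ 2) with (x ^ 2 + 2 * x * s + s ^ 2) by ring.
    rewrite hs2. ring. }
  assert (Es : s = (w ^ 2 - a ^ 2) / (2 * w)).
  { replace s with (w - x - a) by (unfold w; ring). rewrite Ex at 1. field. lra. }
  assert (hl : ln_1_exp (theta a x) = ln (w - a) - ln w).
  { unfold ln_1_exp. rewrite hu. replace (1 - a / w) with ((w - a) / w) by (field; lra).
    apply ln_div; lra. }
  assert (hth : theta a x = ln w - ln a).
  { unfold theta. fold s. fold w. apply ln_div; lra. }
  assert (hlx : ln x = 2 * ln (w - a) - ln 2 - ln w).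
  { rewrite Ex, ln_div by (try apply pow_lt; lra). rewrite ln_pow by lra.
    rewrite ln_mult by lra. simpl. ring. }
  assert (hJ : (RtoC (sq_1_exp (theta a x) / 2) * y)%C = (RtoC x * y / RtoC w)%C).
  { unfold sq_1_exp. rewrite hu.
    replace ((1 - a / w) ^ 2 / 2) with (x / w) by (rewrite Ex; field; lra).
    rewrite RtoC_div by lra. field. intros h; apply RtoC_inj in h; lra. }
  rewrite hJ.
  set (B := BesselJ v _).
  assert (hk : (RtoC (/ s) * beta_sum_kernel (lambda - mu) (2 * mu) (theta a x))%C =
     (Cexp (RtoC (ln 2 - ln (w - a))) * beta_kernel (lambda - mu) (2 * mu) (theta a x))%C).
  { unfold beta_sum_kernel.
    replace (beta_kernel (lambda - mu + 1) (2 * mu) (theta a x)) with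
      (RtoC (a / w) * beta_kernel (lambda - mu) (2 * mu) (theta a x))%C.
    2:{ unfold beta_kernel. rewrite <- hu, <- Cexp_RtoC, <- Cexp_plus. f_equal.
        rewrite RtoC_opp. ring. }
    rewrite Cexp_RtoC.
    replace (exp (ln 2 - ln (w - a))) with (/ s * (1 + a / w)).
    2:{ rewrite <- ln_div, exp_ln by (try apply Rdiv_lt_0_compat; lra). rewrite Es. field.
        assert (0 < w ^ 2 - a ^ 2).
        { replace (w ^ 2 - a ^ 2) with ((w - a) * (w + a)) by ring. apply Rmult_lt_0_compat; lra. }
        repeat split; lra. }
    rewrite RtoC_mult, RtoC_plus. ring. }
  transitivity (Rcpow 2 (- mu) * Rcpow a (mu - lambda) *
    (RtoC (/ s) * beta_sum_kernel (lambda - mu) (2 * mu) (theta a x)) * B)%C; [|ring].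
  rewrite hk. f_equal. unfold Rcpow, beta_kernel. rewrite <- !Cexp_plus. f_equal.
  rewrite hlx, hl, hth. rewrite !RtoC_minus, !RtoC_mult. ring.
Qed.

Theorem corollary2p4 (a : R) (y lambda mu v : C)
    (ha : 0 < a) (hv : - 1 < Re v) (hmu : 0 < Re mu) (hlambda : Re mu < Re lambda) :
  let upper := [((lambda + 1)%C, 1); ((2 * mu)%C, 2)] in
  let lower := [((v + 1)%C, 1); ((1 + lambda + mu)%C, 2); (lambda, 1)] in
  let z := (- y / 2)%C in
  ex_series (V := C_R_NormedModule) (Wright_term upper lower z) /\
  is_RInt_gen (V := C_R_NormedModule)
    (fun x : R =>
       let w := x + a + sqrt (x ^ 2 + 2 * a * x) in
       (Rcpow x (mu - 1) * Rcpow w (- lambda) * BesselJ v (RtoC x * y / RtoC w))%C)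
    (at_right 0) (Rbar_locally p_infty)
    (Rcpow 2 (1 - mu) * Rcpow a (mu - lambda) * Gamma (lambda - mu)
     * Wright_Psi upper lower z)%C.
Proof.
  intros upper lower z.
  set (p := (lambda - mu)%C). set (q := (2 * mu)%C).
  assert (hp : 0 < Re p) by (unfold p, Cminus; rewrite re_plus, Re_opp; lra).
  assert (hq : 0 < Re q) by (unfold q; rewrite re_scal_l; lra).
  assert (hG := Euler_Gamma_neq_0 p hp).
  destruct (is_int_beta_sum_BesselJ p q v y hp hq hv) as [J [HJ HS]].
  assert (h2 : RtoC 2 <> 0%C) by (intros h; apply RtoC_inj in h; lra).
  (* The integrated Bessel series is the Wright series multiplied by 2 Gamma(p). *)
  assert (HW : is_Cseries (Wright_term upper lower z) (J / (2 * Euler_Gamma p))%C).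
  { replace (J / (2 * Euler_Gamma p))%C with (/ (2 * Euler_Gamma p) * J)%C by (field; auto).
    eapply (is_series_ext (V := C_R_NormedModule)); [|apply is_Cseries_mult; exact HS].
    intros n. unfold Wright_term, upper, lower, Cprod, Bessel_coef. simpl fold_right. fold z.
    assert (hn := pos_INR n).
    simpl map. unfold fst, snd. simpl fold_right. fold q.
    rewrite (Gamma_pos (lambda + 1 + RtoC (1 * INR n))), (Gamma_pos (q + RtoC (2 * INR n))),
      (rGamma_pos (1 + lambda + mu + RtoC (2 * INR n))), (rGamma_pos (lambda + RtoC (1 * INR n)))
      by (rewrite ?re_plus, ?re_RtoC; lra).
    replace (p + q + RtoC (2 * INR n) + 1)%C with (1 + lambda + mu + RtoC (2 * INR n))%C
      by (unfold p, q; ring).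
    replace (2 * p + q + RtoC (2 * INR n))%C with (2 * (lambda + RtoC (1 * INR n)))%C
      by (unfold p, q; rewrite Rmult_1_l, RtoC_mult; ring).
    replace (RtoC (1 * INR n) + v + 1)%C with (v + 1 + RtoC (1 * INR n))%C by ring.
    assert (hl : 0 < Re (lambda + RtoC (1 * INR n))) by (rewrite re_plus, re_RtoC; lra).
    replace (lambda + 1 + RtoC (1 * INR n))%C with (lambda + RtoC (1 * INR n) + 1)%C by ring.
    rewrite (Euler_Gamma_succ _ hl).
    assert (hGl := Euler_Gamma_neq_0 _ hl).
    assert (hGm : Euler_Gamma (1 + lambda + mu + RtoC (2 * INR n)) <> 0%C).
    { apply Euler_Gamma_neq_0. rewrite !re_plus, !re_RtoC; lra. }
    set (G1 := Euler_Gamma (lambda + _)) in *. set (G2 := Euler_Gamma (1 + _ + _ + _)) in *.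
    set (L := (lambda + RtoC (1 * INR n))%C).
    match goal with |- @eq _ ?l ?r => change (@eq C l r) end.
    field. repeat split; auto. apply RtoC_fact_neq_0. }
  split; [eexists; exact HW|].
  unfold Wright_Psi. rewrite (CSeries_unique _ _ HW). fold p. rewrite (Gamma_pos p hp).
  replace (Rcpow 2 (1 - mu) * Rcpow a (mu - lambda) * Euler_Gamma p * (J / (2 * Euler_Gamma p)))%C
    with (Rcpow 2 (- mu) * Rcpow a (mu - lambda) * J)%C.
  2:{ (* The factor 2 turns 2^(-mu) into 2^(1 - mu). *)
      replace (Rcpow 2 (1 - mu)) with (2 * Rcpow 2 (- mu))%C.
      - field; auto.
      - unfold Rcpow. rewrite <- (exp_ln 2) at 1 by lra.
        rewrite <- Cexp_RtoC, <- Cexp_plus. f_equal. ring. }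
  eapply is_int_ext; [intros x hx; symmetry; apply (integrand_subst a v y lambda mu x ha hx)|].
  apply is_int_Cmult.
  eapply is_int_ext; [intros x hx; apply scal_R_Cmult|].
  apply (is_RInt_gen_subst (V := C_R_CompleteNormedModule)
    (fun t => (beta_sum_kernel p q t * BesselJ v (RtoC (sq_1_exp t / 2) * y))%C)
    (theta a) (fun x => / sqrt (x ^ 2 + 2 * a * x)) J).
  - intros x hx. apply contC_mult; [apply contC_beta_sum_kernel; auto|].
    apply contC_BesselJ_sq_1_exp; auto.
  - intros; apply theta_pos; auto.
  - intros; apply is_derive_theta; auto.
  - intros; apply continuous_inv_sqrt_quad; auto.
  - apply theta_at_0; auto.
  - apply theta_at_infty; auto.
  - exact HJ.
Qed.
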